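(* Let $X\subset\mathbb R^N$ and let $\mathcal T=(T_\omega)_{\omega\in\Omega}$ be a random dynamical system on $X$ over $(\Omega,B(\Omega),\mathbb P,\theta)$ with an invariant measure $\mu$, and let $\nu$ be the marginal of $\mu$ on $X$. Assume $\underline C_\nu>0$. Then for $\mu\otimes\mu$-almost every $(\omega,x,\tilde\omega,\tilde x)\in\Omega\times X\times\Omega\times X$, $$\limsup_{n\to\infty}\frac{\log m_n^{\omega,\tilde\omega}(x,\tilde x)}{-\log n}\le\frac{2}{\underline C_\nu}.$$ Moreover, suppose that the random dynamical system satisfies the following two assumptions. (a) There exist $r_0>0$, $\xi\ge0$ and $\beta>0$ such that for ($\nu$-)almost every $y\in X$ and any $r_0>r>\rho>0$, $$\nu\big(B(y,r+\rho)\setminus B(y,r-\rho)\big)\le r^{-\xi}\rho^\beta.$$ (b) (Annealed decay of correlations) For all $n\in\mathbb N^*$ and all Hölder observables $\psi,\phi$ from $X$ to $\mathbb R$, $$\left|\int_{\Omega\times X}\psi(T_\omega^n(x))\phi(x)\,d\mu(\omega,x)-\int_{\Omega\times X}\psi\,d\mu\int_{\Omega\times X}\phi\,d\mu\right|\le\|\psi\|_\alpha\|\phi\|_\alpha\,\theta_n,\qquad \theta_n=e^{-n}.$$ Then for $\mu\otimes\mu$-almost every $(\omega,x,\tilde\omega,\tilde x)$, $$\liminf_{n\to\infty}\frac{\log m_n^{\omega,\tilde\omega}(x,\tilde x)}{-\log n}\ge\frac{2}{\overline C_\nu},$$ and if $C_\nu$ exists, then for $\mu\otimes\mu$-almost every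 $(\omega,x,\tilde\omega,\tilde x)$, $$\lim_{n\to\infty}\frac{\log m_n^{\omega,\tilde\omega}(x,\tilde x)}{-\log n}=\frac{2}{C_\nu}.$$
   Context: $(\Omega,\theta,\mathbb P)$ is a probability measure preserving system, where $\Omega$ is a metric space with Borel $\sigma$-algebra $B(\Omega)$. A random dynamical system $\mathcal T=(T_\omega)_{\omega\in\Omega}$ on $X\subset\mathbb R^N$ over $(\Omega,B(\Omega),\mathbb P,\theta)$ is generated by maps $T_\omega:X\to X$ such that $(\omega,x)\mapsto T_\omega(x)$ is measurable; one sets $T_\omega^0=\mathrm{Id}$ and $T_\omega^n=T_{\theta^{n-1}(\omega)}\circ\cdots\circ T_{\theta(\omega)}\circ T_\omega$ for $n\ge1$. The skew-product is $S:\Omega\times X\to\Omega\times X$, $S(\omega,x)=(\theta(\omega),T_\omega(x))$. A probability measure $\mu$ on $\Omega\times X$ is an invariant measure for $\mathcal T$ if $\mu$ is $S$-invariant and $\pi_*\mu=\mathbb P$, where $\pi:\Omega\times X\to\Omega$ is the canonical projection. Writing the decomposition $d\mu(\omega,x)=d\mu_\omega(x)\,d\mathbb P(\omega)$, the marginal of $\mu$ on $X$ is $\nu=\int\mu_\omega\,d\mathbb P(\omega)$. The shortest distance between two random orbits is $$m_n^{\omega,\tilde\omega}(x,\tilde x)=\min_{i,j=0,\dots,n-1}d\big(T_\omega^i(x),T_{\tilde\omega}^j(\tilde x)\big)$$ (with $\log0=-\infty$), $d$ being the distance on $X\subset\mathbb R^N$. The lower and upper correlation dimensions of $\nu$ are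 $$\underline C_\nu=\liminf_{r\to0}\frac{\log\int_X\nu(B(x,r))\,d\nu(x)}{\log r},\qquad \overline C_\nu=\limsup_{r\to0}\frac{\log\int_X\nu(B(x,r))\,d\nu(x)}{\log r},$$ where $B(x,r)$ is the ball of center $x$ and radius $r$; if the limit exists, the common value is denoted $C_\nu$. Hölder observables are functions $\psi:X\to\mathbb R$ with finite Hölder norm $\|\psi\|_\alpha=\sup_X|\psi|+\sup_{x\ne x'}\frac{|\psi(x)-\psi(x')|}{d(x,x')^\alpha}$ for a fixed exponent $\alpha\in(0,1]$. In (b), $\int_{\Omega\times X}\psi\,d\mu$ means $\int_{\Omega\times X}\psi(x)\,d\mu(\omega,x)$. *)

(* Defs.v *)
From HB Require Import structures.
From mathcomp Require Import all_boot all_order all_algebra.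
From mathcomp Require Import all_classical all_reals all_analysis.

Set Implicit Arguments.
Unset Strict Implicit.
Unset Printing Implicit Defensive.

Import Order.TTheory GRing.Theory Num.Theory.
Import numFieldTopology.Exports numFieldNormedType.Exports.

Local Open Scope classical_set_scope.
Local Open Scope ring_scope.

(* A measurableType must be pointed, which neither a metricType nor a subset of
   R^N is.  A space carrying a probability measure is nonempty, so we pick a
   point of it; the sigma-algebra does not depend on that point. *)
Definition pointed_at (T : choiceType) (t0 : T) : Type := T.

HB.instance Definition _ (T : choiceType) (t0 : T) :=
  Choice.on (pointed_at t0).
HB.instance Definition _ (T : choiceType) (t0 : T) :=
  isPointed.Build (pointed_at t0) t0.

Definition opens_at (T : topologicalType) (t0 : T) :
  set (set (pointed_at t0)) := @open T.

Arguments opens_at {T} t0 _.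

Notation borel t0 := (g_sigma_algebraType (opens_at t0)).

Definition measure_preserving d (T : measurableType d) (R : realType)
    (m : {measure set T -> \bar R}) (f : T -> T) : Prop :=
  measurable_fun setT f /\
  forall A, measurable A -> pushforward m f A = m A.

Section random_dynamical_system.
Context (R : realType) (N : nat).
Context (Omega : topologicalType) (w0 : Omega).
Context (X : set 'rV[R]_N) (x0 : X).
Implicit Types (theta : Omega -> Omega) (T : Omega -> X -> X).

Definition is_rds (P : probability (borel w0) R) theta T : Prop :=
  measure_preserving P theta /\
  measurable_fun setT
    (fun z : borel w0 * borel x0 => T z.1 z.2 : borel x0).

Fixpoint rds_iter theta T (n : nat) (w : Omega) (x : X) : X :=
  if n is k.+1 then T (iter k theta w) (rds_iter theta T k w x) else x.

Definition skew_product theta T (z : borel w0 * borel x0) :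
  borel w0 * borel x0 := (theta z.1, T z.1 z.2).

Definition rds_invariant (P : probability (borel w0) R) theta T
    (mu : probability (borel w0 * borel x0)%type R) : Prop :=
  measure_preserving mu (skew_product theta T) /\
  forall A : set (borel w0), measurable A -> pushforward mu fst A = P A.

Definition proj_X (z : borel w0 * borel x0) : borel x0 := z.2.

HB.instance Definition _ :=
  isMeasurableFun.Build _ _ _ _ proj_X measurable_snd.

Definition marginal (mu : probability (borel w0 * borel x0)%type R) :
  probability (borel x0) R := distribution mu proj_X.

(* Agreement with the definition by disintegration, whenever mu has one. *)
Lemma marginal_disintegration (mu : probability (borel w0 * borel x0)%type R)
    (P : probability (borel w0) R)
    (mu_ : R.-pker (borel w0) ~> (borel x0)) :
  (forall A, measurable A -> mu A = \int[P]_w mu_ w (xsection A w))%E ->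
  forall B, measurable B -> marginal mu B = (\int[P]_w mu_ w B)%E.
Proof.
move=> muE B mB.
have -> : marginal mu B = mu (snd @^-1` B) by [].
rewrite muE.
  by apply: eq_integral => w _; rewrite xsection_preimage_snd.
by rewrite -[X in measurable X]setTI; exact: measurable_snd.
Qed.

Definition eucl_dist (x y : X) : R :=
  Num.sqrt (\sum_(i < N) (set_val x ord0 i - set_val y ord0 i) ^+ 2).

Definition eucl_ball (x : X) (r : R) : set (borel x0) :=
  [set y | eucl_dist x y < r].

Definition shortest_dist theta T (n : nat) (w w' : Omega) (x x' : X) : \bar R :=
  \big[mine/+oo%E]_(i < n) \big[mine/+oo%E]_(j < n)
    (eucl_dist (rds_iter theta T i w x) (rds_iter theta T j w' x'))%:E.

(* lne 0 = -oo *)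
Definition shortest_rate theta T (z : (Omega * X) * (Omega * X)) (n : nat) :
    \bar R :=
  (lne (shortest_dist theta T n z.1.1 z.2.1 z.1.2 z.2.2) /
     (- ln n%:R)%:E)%E.

Definition corr_rate (nu : probability (borel x0) R) (r : R) : \bar R :=
  (lne (\int[nu]_x nu (eucl_ball x r)) / (ln r)%:E)%E.

Definition lower_corr_dim (nu : probability (borel x0) R) : \bar R :=
  limf_einf (corr_rate nu) 0^'+.

Definition upper_corr_dim (nu : probability (borel x0) R) : \bar R :=
  limf_esup (corr_rate nu) 0^'+.

(* maxe 0 only matters when X is a singleton: the supremum of the empty set
   is -oo. *)
Definition holder_norm (alpha : R) (psi : X -> R) : \bar R :=
  (ereal_sup [set `|psi x|%:E | x in setT] +
   maxe 0 (ereal_sup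
     [set (`|psi z.1 - psi z.2| / eucl_dist z.1 z.2 `^ alpha)%:E |
        z in [set z : X * X | z.1 <> z.2]]))%E.

Definition annulus_regular (nu : probability (borel x0) R) : Prop :=
  exists r0 xi beta : R, [/\ 0 < r0, 0 <= xi, 0 < beta &
    {ae nu, forall y, forall r rho : R, 0 < rho -> rho < r -> r < r0 ->
      (nu (eucl_ball y (r + rho) `\` eucl_ball y (r - rho)) <=
         (r `^ (- xi) * rho `^ beta)%:E)%E}].

Definition annealed_decay (alpha : R) theta T
    (mu : probability (borel w0 * borel x0)%type R) : Prop :=
  forall (n : nat) (psi phi : X -> R), (0 < n)%N ->
    (holder_norm alpha psi < +oo)%E -> (holder_norm alpha phi < +oo)%E ->
    (`| \int[mu]_z (psi (rds_iter theta T n z.1 z.2) * phi z.2)%:E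
        - (\int[mu]_z (psi z.2)%:E) * (\int[mu]_z (phi z.2)%:E) |
     <= holder_norm alpha psi * holder_norm alpha phi
        * (expR (- n%:R))%:E)%E.

End random_dynamical_system.

(* Main.v *)
Require Import Defs.
From mathcomp Require Import all_boot all_order all_algebra.
From mathcomp Require Import all_classical all_reals all_analysis.
From mathcomp Require Import measurable_realfun ring lra zify.
Set Implicit Arguments.
Unset Strict Implicit.
Unset Printing Implicit Defensive.
Import Order.TTheory GRing.Theory Num.Theory.
Import numFieldTopology.Exports numFieldNormedType.Exports.
Local Open Scope classical_set_scope.
Local Open Scope ring_scope.

(**
The proof works along [n = 2 ^ l] and [r = b ^ l] with [b = 2 ^ (- k)], which
suffices because the shortest distance is nonincreasing in [n] and
[2 ^ l <= n < 2 ^ l.+1] determines [ln n] up to a factor tending to 1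
([slope_le_of_pow2], [slope_ge_of_pow2]).  Write [M r] for the correlation
integral, i.e. the integral of [nu (B (x, r))] against [nu]: it is at most
[r ^ c] for small [r] if [c] is below the lower correlation dimension, and at
least [r ^ c] if [c] is above the upper one.

Upper bound.  By invariance every point of an orbit has law [nu], so the
expected number of pairs of times [i, j < n] at which the two orbits are at
distance less than [r] is [n ^ 2 * M r] ([hit_prob_le]).  If [2 < k * c] with [c]
below the lower dimension, this is a geometric sequence in [l] of ratio less
than 1, and the Borel-Cantelli lemma ([ae_eventually_notin]) concludes.

Lower bound.  The indicator of [d (x, y) < r] is replaced by a kernel
([smooth_ball]) that is Lipschitz of constant [2 / r].  It lies between the
indicators of the balls of radii [r / 2] and [r]; let [H] be its double integral
against [nu] and [h y] its integral in the first variable.  Let [S] be the sum of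
the kernel over all pairs of times [i, j < n]; its mean is [n ^ 2 * H].  For the
second moment, expand [S ^ 2] over [i, i', j, j'].  If [i] and [i'] are at least
[g] apart, the kernel with its second argument frozen is a Hoelder observable, so
the decay of correlations for the first orbit replaces the product of two
kernels by [h (x'_j) * h (x'_j')] up to [exp (- g)]; since [h] is again
Lipschitz, the decay along the second orbit gives [H ^ 2] if [j] and [j'] are also
apart.  If exactly one pair of times is close, what remains is at most
[H * sup h], and if both are close the term is at most [H].

What makes these near-diagonal terms negligible is the bound
[sup h <= K * sqrt H] ([smooth_measure_le_sqrt]): a ball of radius [r] is covered
by a bounded number [K] of cells of diameter less than [r / 2], and two independent
points of law [nu] both fall into a given cell [C] with probability
[nu C ^ 2 <= H].  Chebyshev's inequality then gives ([second_moment_hitting])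
[[
  P (S = 0) <= 2 * eps / H ^ 2 + 4 * g * K / (n * sqrt H) + 4 * g ^ 2 / (n ^ 2 * H)
]]
with [eps] of order [r ^ (- 2) * exp (- g)].  When [k * c < 2] for some [c] above
the upper dimension, [n * sqrt H] grows geometrically in [l]; choosing [g] linear in
[l] makes the bound summable ([second_moment_geometric]), and Borel-Cantelli
applies again, since [S <> 0] forces two orbit points to be at distance less than
[r].
*)

(** * Integrals of bounded nonnegative functions *)

Section bounded_functions.
Context d (T : measurableType d) (R : realType).
Implicit Types (f g : T -> R) (m : probability T R).

(** Bounded nonnegative measurable functions: their integrals against
   probability measures are finite, so that one can compute with real-valued
   integrals. *)
Definition bnd_meas f :=
  measurable_fun setT f /\ exists B : R, forall x, 0 <= f x <= B.

Lemma bnd_meas_ge0 f : bnd_meas f -> forall x, 0 <= f x.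
Proof. by move=> [_ [B fB]] x; case/andP: (fB x). Qed.

Lemma bnd_meas_cst (c : R) : 0 <= c -> bnd_meas (fun=> c).
Proof. by move=> c0; split; [exact: measurable_cst|exists c => _; rewrite c0/=]. Qed.

Lemma bnd_measD f g : bnd_meas f -> bnd_meas g -> bnd_meas (fun x => f x + g x).
Proof.
move=> [mf [B fB]] [mg [C gC]]; split; first exact: measurable_funD.
exists (B + C) => x; have /andP[? ?] := fB x; have /andP[? ?] := gC x.
by rewrite addr_ge0//= lerD.
Qed.

Lemma bnd_measM f g : bnd_meas f -> bnd_meas g -> bnd_meas (fun x => f x * g x).
Proof.
move=> [mf [B fB]] [mg [C gC]]; split; first exact: measurable_funM.
exists (B * C) => x; have /andP[? ?] := fB x; have /andP[? ?] := gC x.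
by rewrite mulr_ge0//= ler_pM.
Qed.

Lemma bnd_meas_sum (I : finType) (F : I -> T -> R) :
  (forall i, bnd_meas (F i)) -> bnd_meas (fun x => \sum_i F i x).
Proof.
move=> bF; split; first by apply: measurable_sum => i; exact: (bF i).1.
have [B BF] := choice (fun i => (bF i).2).
exists (\sum_i B i) => x; rewrite sumr_ge0/=; last first.
  by move=> i _; exact: bnd_meas_ge0.
by apply: ler_sum => i _; case/andP: (BF i x).
Qed.

Lemma bnd_meas_indic (A : set T) : measurable A -> bnd_meas (\1_A : T -> R).
Proof.
move=> mA; split; first exact: measurable_indic.
by exists 1 => x; rewrite indicE; case: (_ \in _); rewrite /= ?lexx ?ler01.
Qed.

Lemma bnd_meas_integrable m f : bnd_meas f -> m.-integrable setT (EFin \o f).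
Proof.
move=> [mf [B fB]]; apply: measurable_bounded_integrable => //.
  by rewrite (le_lt_trans (probability_le1 _ _)) ?ltry.
exists B; split; first exact: num_real.
move=> M BM x _ /=; have /andP[f0 fx] := fB x.
by rewrite ger0_norm// (le_trans fx)// ltW.
Qed.

Lemma bnd_meas_EFin m f : bnd_meas f ->
  (\int[m]_x (f x)%:E)%E = (\int[m]_x f x)%:E.
Proof.
move=> bf; rewrite /Rintegral fineK//.
by apply: integrable_fin_num => //; exact: bnd_meas_integrable.
Qed.

Lemma le_bnd_integral m f g : bnd_meas f -> bnd_meas g ->
  (forall x, f x <= g x) -> \int[m]_x f x <= \int[m]_x g x.
Proof.
by move=> bf bg fg; apply: le_Rintegral => //; exact: bnd_meas_integrable.
Qed.

Lemma bnd_integralD m f g : bnd_meas f -> bnd_meas g ->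
  \int[m]_x (f x + g x) = \int[m]_x f x + \int[m]_x g x.
Proof. by move=> bf bg; apply: RintegralD => //; exact: bnd_meas_integrable. Qed.

Lemma bnd_integralZl m f (c : R) : bnd_meas f ->
  \int[m]_x (c * f x) = c * \int[m]_x f x.
Proof. by move=> bf; apply: RintegralZl => //; exact: bnd_meas_integrable. Qed.

Lemma prob_integral_cst m (c : R) : \int[m]_x c = c.
Proof. by rewrite Rintegral_cst//= [X in fine X](@probability_setT _ _ _ m) mulr1. Qed.

Lemma bnd_integral_sum m (I : finType) (F : I -> T -> R) :
  (forall i, bnd_meas (F i)) ->
  \int[m]_x (\sum_i F i x) = \sum_i \int[m]_x F i x.
Proof.
move=> bF; apply: EFin_inj; rewrite -bnd_meas_EFin; last exact: bnd_meas_sum.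
under eq_integral do rewrite -sumEFin.
rewrite ge0_integral_sum//.
- by rewrite -sumEFin; apply: eq_bigr => i _; rewrite bnd_meas_EFin.
- by move=> i; apply/measurable_EFinP; exact: (bF i).1.
- by move=> i x _; rewrite lee_fin; exact: bnd_meas_ge0.
Qed.

Lemma bnd_integral_indic m (A : set T) : measurable A ->
  m A = (\int[m]_x (\1_A x : R))%:E.
Proof.
move=> mA; rewrite -bnd_meas_EFin; last exact: bnd_meas_indic.
by rewrite integral_indic// setIT.
Qed.

Lemma bnd_integral_le1 m f : bnd_meas f -> (forall x, f x <= 1) ->
  \int[m]_x f x <= 1.
Proof.
move=> bf f1; rewrite -[leRHS](prob_integral_cst m).
by apply: le_bnd_integral => //; exact: bnd_meas_cst.
Qed.

End bounded_functions.

Lemma bnd_meas_comp d d' (T : measurableType d) (T' : measurableType d')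
    (R : realType) (f : T' -> R) (p : T -> T') :
  measurable_fun setT p -> bnd_meas f -> bnd_meas (f \o p).
Proof.
move=> mp [mf [B fB]]; split; first exact: measurableT_comp.
by exists B => x; exact: fB.
Qed.

Section bounded_fubini.
Context d1 d2 (T1 : measurableType d1) (T2 : measurableType d2) (R : realType).
Context (m1 : probability T1 R) (m2 : probability T2 R) (f : T1 * T2 -> R).
Hypothesis bf : bnd_meas f.

Let mf : measurable_fun setT (EFin \o f).
Proof. by apply/measurable_EFinP; exact: bf.1. Qed.
Let f0 z : (0 <= (EFin \o f) z)%E.
Proof. by rewrite lee_fin; exact: bnd_meas_ge0. Qed.

Lemma bnd_meas_xsection x : bnd_meas (fun y => f (x, y)).
Proof. exact: (bnd_meas_comp (pair1_measurable x) bf). Qed.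

Lemma bnd_meas_ysection y : bnd_meas (fun x => f (x, y)).
Proof. exact: (bnd_meas_comp (pair2_measurable y) bf). Qed.

Lemma bnd_meas_integral2 : bnd_meas (fun x => \int[m2]_y f (x, y)).
Proof.
split.
  apply/measurable_EFinP.
  rewrite (_ : _ \o _ = fubini_F m2 (EFin \o f)).
    exact: measurable_fun_fubini_tonelli_F.
  apply/funext => x /=; rewrite /fubini_F bnd_meas_EFin//.
  exact: bnd_meas_xsection.
have [B fB] := bf.2; exists B => x; apply/andP; split.
  by apply: Rintegral_ge0 => y _; exact: bnd_meas_ge0.
rewrite -[leRHS](prob_integral_cst m2).
apply: le_bnd_integral => [||y]; first exact: bnd_meas_xsection.
  by apply: bnd_meas_cst; case/andP: (fB (point, point)) => /le_trans; exact.
by case/andP: (fB (x, y)).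
Qed.

Lemma bnd_meas_integral1 : bnd_meas (fun y => \int[m1]_x f (x, y)).
Proof.
split.
  apply/measurable_EFinP.
  rewrite (_ : _ \o _ = fubini_G m1 (EFin \o f)).
    exact: measurable_fun_fubini_tonelli_G.
  apply/funext => y /=; rewrite /fubini_G bnd_meas_EFin//.
  exact: bnd_meas_ysection.
have [B fB] := bf.2; exists B => y; apply/andP; split.
  by apply: Rintegral_ge0 => x _; exact: bnd_meas_ge0.
rewrite -[leRHS](prob_integral_cst m1).
apply: le_bnd_integral => [||x]; first exact: bnd_meas_ysection.
  by apply: bnd_meas_cst; case/andP: (fB (point, point)) => /le_trans; exact.
by case/andP: (fB (x, y)).
Qed.

Lemma bnd_fubini1 :
  (\int[(m1 \x m2)%E]_z f z = \int[m1]_x (\int[m2]_y f (x, y)))%R.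
Proof.
apply: EFin_inj; rewrite -!bnd_meas_EFin//; last exact: bnd_meas_integral2.
rewrite fubini_tonelli1//; apply: eq_integral => x _.
by rewrite -bnd_meas_EFin//; exact: bnd_meas_xsection.
Qed.

Lemma bnd_fubini2 :
  (\int[(m1 \x m2)%E]_z f z = \int[m2]_y (\int[m1]_x f (x, y)))%R.
Proof.
apply: EFin_inj; rewrite -!bnd_meas_EFin//; last exact: bnd_meas_integral1.
rewrite fubini_tonelli2//; apply: eq_integral => y _.
by rewrite -bnd_meas_EFin//; exact: bnd_meas_ysection.
Qed.

End bounded_fubini.

Lemma bnd_integral_pushforward d d' (T : measurableType d)
    (T' : measurableType d') (R : realType) (m : probability T R)
    (m' : probability T' R) (p : T -> T') (f : T' -> R) :
  measurable_fun setT p ->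
  (forall A, measurable A -> pushforward m p A = m' A) ->
  bnd_meas f -> \int[m]_x f (p x) = \int[m']_y f y.
Proof.
move=> mp mE bf; apply: EFin_inj; rewrite -!bnd_meas_EFin//; last first.
  exact: (bnd_meas_comp mp bf).
have /= <- := @ge0_integral_pushforward _ _ _ _ _ _ mp m setT (EFin \o f).
- by apply: eq_measure_integral => A mA _; exact: mE.
- by [].
- by apply/measurable_EFinP; exact: bf.1.
- by move=> x _; rewrite lee_fin; exact: bnd_meas_ge0.
Qed.

(** * The first Borel-Cantelli lemma under a geometric bound *)

Section borel_cantelli.
Context d (T : measurableType d) (R : realType) (m : {measure set T -> \bar R}).

Lemma ae_eventually_notin (F : (set T)^nat) (D q : R) (l0 : nat) :
  (forall l, measurable (F l)) -> 0 <= D -> 0 < q < 1 ->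
  (forall l, (l0 <= l)%N -> (m (F l) <= (D * q ^+ l)%:E)%E) ->
  {ae m, forall z, exists L, forall l, (L <= l)%N -> ~ F l z}.
Proof.
move=> mF D0 /andP[q0 q1] FD.
pose G l := F (l + l0)%N.
have G0 : m (lim_sup_set G) = 0%E.
  apply: lim_sup_set_cvg0 => [l|]; first exact: mF.
  apply: (@le_lt_trans _ _ (D * q ^+ l0 / (1 - q))%:E); last exact: ltry.
  apply: lime_le; first exact: is_cvg_nneseries.
  apply: nearW => n; apply: (@le_trans _ _
      (series (geometric (D * q ^+ l0) q) n)%:E); last first.
    rewrite lee_fin geometric_le_lim// ?ger0_norm// ?mulr_ge0// ?exprn_ge0//.
    - exact: ltW.
    - exact: ltW.
  rewrite seriesEnat/= -sumEFin; apply: lee_sum => i _.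
  rewrite /G (le_trans (FD _ _)) ?leq_addl// lee_fin exprD.
  by rewrite [X in _ * X]mulrC mulrA.
exists (lim_sup_set G); split => //.
  by apply: bigcapT_measurable => n; apply: bigcup_measurable => k _; exact: mF.
move=> z /= zF n _; apply: contra_notP zF => /= nG.
exists (n + l0)%N => l nl Fz; apply: nG; exists (l - l0)%N => /=; first by lia.
by rewrite /G subnK//; lia.
Qed.

End borel_cantelli.

(** * Superior limits and logarithmic slopes *)

Section limf.
Context (T : choiceType) (X : filteredType T) (R : realType).
Context (F : set (set X)) {FF : Filter F}.
Implicit Types (f : X -> \bar R) (c : \bar R).

Lemma limf_esup_lt f c : (limf_esup f F < c)%E -> F [set x | (f x < c)%E].
Proof.
rewrite limf_esupE => /ereal_inf_lt[_ [V FV <-] supc].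
apply: filterS FV => x Vx; apply: le_lt_trans supc.
by apply: ereal_sup_ubound; exists x.
Qed.

Lemma limf_einf_gt f c : (c < limf_einf f F)%E -> F [set x | (c < f x)%E].
Proof.
rewrite limf_einfE => /ereal_sup_gt[_ [V FV <-] cinf].
apply: filterS FV => x Vx; apply: lt_le_trans cinf _.
by apply: ereal_inf_lbound; exists x.
Qed.

Lemma limf_esup_le f c : F [set x | (f x <= c)%E] -> (limf_esup f F <= c)%E.
Proof.
move=> fc; rewrite limf_esupE.
apply: (@le_trans _ _ (ereal_sup [set f x | x in [set x | (f x <= c)%E]])).
  by apply: ereal_inf_lbound; exists [set x | (f x <= c)%E].
by apply: ge_ereal_sup => _ [x /= fx <-].
Qed.

Lemma limf_einf_ge f c : F [set x | (c <= f x)%E] -> (c <= limf_einf f F)%E.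
Proof.
move=> fc; rewrite limf_einfE.
apply: (@le_trans _ _ (ereal_inf [set f x | x in [set x | (c <= f x)%E]])).
  by apply: le_ereal_inf_tmp => _ [x /= fx <-].
by apply: ereal_sup_ubound; exists [set x | (c <= f x)%E].
Qed.

End limf.

Section rates.
Context (R : realType).
Implicit Types (a b c k r : R) (x : \bar R).

Lemma ediv_EFinE x a : a != 0 -> (x / a%:E)%E = (x * (a^-1)%:E)%E.
Proof. by move=> a0; rewrite inver (negbTE a0). Qed.

(** A lower bound on a log-log slope is an upper bound by a power, since
   [ln r] is negative. *)
Lemma powR_le_of_slope_gt a r c : 0 <= a -> 0 < r < 1 ->
  (c%:E < lne a%:E / (ln r)%:E)%E -> a <= r `^ c.
Proof.
move=> a0 /andP[r0 r1]; have lnr : ln r < 0 by rewrite ln_lt0// r0.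
rewrite ediv_EFinE ?lt_eqF// lte_ndivlMr// => H.
move: a0; rewrite le_eqVlt => /predU1P[<-|a0]; first exact: powR_ge0.
move: H; rewrite lne_EFin// -EFinM lte_fin => /ltW.
by rewrite -ln_powR ler_ln// posrE powR_gt0.
Qed.

Lemma powR_ge_of_slope_lt a r c : 0 <= a -> 0 < r < 1 ->
  (lne a%:E / (ln r)%:E < c%:E)%E -> r `^ c <= a.
Proof.
move=> a0 /andP[r0 r1]; have lnr : ln r < 0 by rewrite ln_lt0// r0.
rewrite ediv_EFinE ?lt_eqF// lte_ndivrMr// => H.
move: a0; rewrite le_eqVlt => /predU1P[a0|a0].
  by move: H; rewrite -a0 le0_lneNy.
move: H; rewrite lne_EFin// -EFinM lte_fin => /ltW.
by rewrite -ln_powR ler_ln// posrE powR_gt0.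
Qed.

Lemma le_lne x y : (0 <= x)%E -> (x <= y)%E -> (lne x <= lne y :> \bar R)%E.
Proof.
move=> x0 xy; rewrite lee_lne//= in_itv/= leey andbT//.
exact: le_trans xy.
Qed.

(** Slopes along a nonincreasing sequence are controlled by its values at the
   powers of two: [2 ^ l <= n < 2 ^ l.+1] determines [ln n] up to a factor
   tending to 1. *)
Section slope.
Variable u : nat -> \bar R.
Hypothesis u0 : forall n, (0 <= u n)%E.
Hypothesis u_dec : forall m n, (m <= n)%N -> (u n <= u m)%E.

Let slope n := (lne (u n) / (- ln n%:R)%:E)%E.

Let ln_nat_gt0 n : (1 < n)%N -> 0 < ln n%:R :> R.
Proof. by move=> n1; rewrite ln_gt0// ltr1n. Qed.

Let slope_le n k : (1 < n)%N ->
  ((- (k * ln n%:R))%:E <= lne (u n))%E -> (slope n <= k%:E)%E.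
Proof.
move=> n1 h; have ln0 := ln_nat_gt0 n1.
rewrite /slope ediv_EFinE ?oppr_eq0 ?gt_eqF// lee_ndivrMr ?oppr_lt0//.
by rewrite -EFinM mulrN.
Qed.

Let slope_ge n k : (1 < n)%N ->
  (lne (u n) <= (- (k * ln n%:R))%:E)%E -> (k%:E <= slope n)%E.
Proof.
move=> n1 h; have ln0 := ln_nat_gt0 n1.
rewrite /slope ediv_EFinE ?oppr_eq0 ?gt_eqF// lee_ndivlMr ?oppr_lt0//.
by rewrite -EFinM mulrN.
Qed.

Let ln2_gt0 : 0 < ln 2 :> R. Proof. by rewrite ln_gt0// ltr1n. Qed.

Let lne_pow2 k l : lne ((2 `^ (- k)) ^+ l)%:E = (- (k * (l%:R * ln 2)))%:E :> \bar R.
Proof.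
rewrite lne_EFin ?exprn_gt0 ?powR_gt0// lnXn ?powR_gt0// ln_powR.
by rewrite -mulr_natl; congr EFin; ring.
Qed.

Let trunc_log_ge l n : (2 ^ l <= n)%N -> (l <= trunc_log 2 n)%N.
Proof. exact: trunc_log_max. Qed.

Let ln_bounds n : (0 < n)%N ->
  (trunc_log 2 n)%:R * ln 2 <= ln n%:R :> R /\
  ln n%:R <= (trunc_log 2 n).+1%:R * ln 2 :> R.
Proof.
move=> n0; have /andP[h1 h2] := trunc_log_bounds (ltnSn 1) n0.
by split; rewrite mulr_natl -lnXn// ler_ln ?posrE ?exprn_gt0 ?ltr0n// -natrX
  ler_nat// ltnW.
Qed.

Lemma slope_le_of_pow2 k k' : 0 < k -> k < k' ->
  (exists L, forall l, (L <= l)%N -> (((2 `^ (- k)) ^+ l)%:E <= u (2 ^ l)%N)%E) ->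
  \forall n \near \oo, (slope n <= k'%:E)%E.
Proof.
move=> k0 kk' [L uL].
have kk'0 : 0 < k' - k by rewrite subr_gt0.
exists (2 ^ (maxn L (Num.truncn (k / (k' - k))).+1))%N => // n /= nL.
have /trunc_log_ge := nL; rewrite geq_max => /andP[Ll tl].
have n1 : (1 < n)%N.
  apply: leq_trans nL; rewrite (leq_trans (ltn_expl 1 (ltnSn 1)))// leq_exp2l//.
  by rewrite leq_max orbT.
set l := trunc_log 2 n in Ll tl.
apply: slope_le => //; apply: (@le_trans _ _ (lne ((2 `^ (- k)) ^+ l.+1)%:E)).
  rewrite lne_pow2 lee_fin lerN2.
  have [h1 h2] := ln_bounds (ltnW n1).
  have k'0 : 0 < k' by exact: lt_trans kk'.
  apply: (@le_trans _ _ (k' * (l%:R * ln 2))); last by rewrite ler_pM2l.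
  rewrite !mulrA ler_pM2r// -natr1.
  have : k / (k' - k) <= l%:R.
    by rewrite ltW// (lt_le_trans (truncnS_gt _))// ler_nat.
  by rewrite ler_pdivrMr// => ?; lra.
apply: le_lne; first by rewrite lee_fin exprn_ge0// powR_ge0.
rewrite (le_trans (uL l.+1 _))//; first exact: leqW.
by apply: u_dec; rewrite ltnW// trunc_log_ltn.
Qed.

Lemma slope_ge_of_pow2 k k' : 0 <= k' -> k' < k ->
  (exists L, forall l, (L <= l)%N -> (u (2 ^ l)%N <= ((2 `^ (- k)) ^+ l)%:E)%E) ->
  \forall n \near \oo, (k'%:E <= slope n)%E.
Proof.
move=> k'0 kk' [L uL].
have kk'0 : 0 < k - k' by rewrite subr_gt0.
exists (2 ^ (maxn L (Num.truncn (k' / (k - k'))).+1))%N => // n /= nL.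
have /trunc_log_ge := nL; rewrite geq_max => /andP[Ll tl].
have n1 : (1 < n)%N.
  apply: leq_trans nL; rewrite (leq_trans (ltn_expl 1 (ltnSn 1)))// leq_exp2l//.
  by rewrite leq_max orbT.
set l := trunc_log 2 n in Ll tl.
apply: slope_ge => //; apply: (@le_trans _ _ (lne ((2 `^ (- k)) ^+ l)%:E)).
  apply: le_lne => //; apply: le_trans (uL l Ll).
  by apply: u_dec; rewrite trunc_logP// ltnW.
rewrite lne_pow2 lee_fin lerN2.
have [h1 h2] := ln_bounds (ltnW n1).
apply: (@le_trans _ _ (k' * (l.+1%:R * ln 2))); first by rewrite ler_wpM2l.
rewrite !mulrA ler_pM2r// -natr1.
have : k' / (k - k') <= l%:R.
  by rewrite ltW// (lt_le_trans (truncnS_gt _))// ler_nat.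
by rewrite ler_pdivrMr// => ?; lra.
Qed.

(** A nonincreasing sequence has lower slope at least 0 as soon as its first term
   is finite; this is all that is needed when the upper dimension is infinite. *)
Lemma slope_ge_of_fin k : (u 1 < +oo)%E -> k < 0 ->
  \forall n \near \oo, (k%:E <= slope n)%E.
Proof.
move=> u1 k0.
have [A uA] : exists A : R, (u 1 <= (expR A)%:E)%E.
  exists (fine (u 1)); rewrite -[X in (X <= _)%E]fineK ?ge0_fin_numE//.
  by rewrite lee_fin; apply: le_trans (expR_ge1Dx _); rewrite lerDr.
exists (maxn 2 (Num.truncn (expR (A / - k))).+1) => // n /=.
rewrite geq_max => /andP[n1 nA].
apply: slope_ge => //; apply: (@le_trans _ _ (lne (expR A)%:E)).
  apply: le_lne => //; apply: le_trans uA; apply: u_dec; exact: ltnW.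
rewrite lne_EFin ?expR_gt0// expRK lee_fin -mulNr.
rewrite -ler_pdivrMl ?oppr_gt0// mulrC -[leLHS]expRK.
rewrite ler_ln ?posrE ?expR_gt0 ?ltr0n//; last exact: ltnW.
by rewrite ltW// (lt_le_trans (truncnS_gt _))// ler_nat.
Qed.

End slope.
End rates.

(** * A second moment estimate *)

(** Times at distance less than [g]. *)
Definition close_times (g i i' : nat) : bool := (i < i' + g)%N && (i' < i + g)%N.

Lemma sum_close_times_le (R : realType) (g n i : nat) :
  \sum_(i' < n) (close_times g i i')%:R <= (2 * g)%:R :> R.
Proof.
rewrite -natr_sum ler_nat.
rewrite (eq_bigr (fun i' : 'I_n => if close_times g i i' then 1 else 0)%N);
  last by move=> k _; case: ifP.
rewrite -(big_mkord predT (fun i' => if close_times g i i' then 1 else 0)%N) -big_mkcond/=.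
rewrite sum1_count; rewrite (leq_trans _ (_ : size (iota (i - g) (2 * g)) <= _)%N)//; last first.
  by rewrite size_iota.
rewrite -size_filter; apply: uniq_leq_size.
  by rewrite filter_uniq// iota_uniq.
move=> k; rewrite mem_filter /close_times !mem_iota; lia.
Qed.

(** The quadratic inequality behind Chebyshev's bound for the event that a
   nonnegative variable of mean [e] vanishes. *)
Lemma mean_sqr_indic_le (R : realType) (T : Type) (s : T -> R) (e : R) t :
  e ^+ 2 * \1_[set t | s t = 0] t + 2 * e * s t <= s t * s t + e ^+ 2.
Proof.
rewrite indicE; case: (boolP (t \in _)) => [|_]; rewrite ?inE/=.
  by move=> ->; lra.
by have := sqr_ge0 (s t - e); rewrite !expr2; lra.
Qed.

Lemma second_moment_arith (R : realType) (n g H eps S P Q : R) :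
  0 < n -> 0 < H ->
  (n ^+ 2 * H) ^+ 2 * P + 2 * (n ^+ 2 * H) * (n ^+ 2 * H) <=
    Q + (n ^+ 2 * H) ^+ 2 ->
  Q <= n ^+ 2 * (n ^+ 2 * (H ^+ 2 + 2 * eps) + 4 * n * g * (S * H) +
    4 * g ^+ 2 * H) ->
  P <= 2 * eps / H ^+ 2 + 4 * g * S / (n * H) + 4 * g ^+ 2 / (n ^+ 2 * H).
Proof.
move=> n0 H0 h1 h2.
have e2 : 0 < (n ^+ 2 * H) ^+ 2 by rewrite exprn_gt0// mulr_gt0// exprn_gt0.
rewrite -(ler_pM2l e2).
apply: (@le_trans _ _ (n ^+ 2 * (n ^+ 2 * (H ^+ 2 + 2 * eps) +
    4 * n * g * (S * H) + 4 * g ^+ 2 * H) - (n ^+ 2 * H) ^+ 2)); first by lra.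
rewrite le_eqVlt; apply/orP; left; apply/eqP; field.
by rewrite !gt_eqF.
Qed.

Section second_moment.
Context d d' (Z : measurableType d) (Y : measurableType d') (R : realType).
Context (m : probability Z R) (nu : probability Y R).
Context (x : nat -> Z -> Y) (kap : Y * Y -> R) (g : nat) (eps S : R).
Let h y := \int[nu]_a kap (a, y).
Let H := \int[nu]_y h y.

Hypothesis mx : forall i, measurable_fun setT (x i).
Hypothesis kap_bnd : bnd_meas kap.
Hypothesis kap_le1 : forall z, kap z <= 1.
Hypothesis kap_sym : forall a b, kap (a, b) = kap (b, a).
Hypothesis law_x : forall i (f : Y -> R), bnd_meas f ->
  \int[m]_z f (x i z) = \int[nu]_y f y.
Hypothesis eps0 : 0 <= eps.
Hypothesis dec_kap : forall i i' y y', ~~ close_times g i i' ->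
  \int[m]_z (kap (x i z, y) * kap (x i' z, y')) <= h y * h y' + eps.
Hypothesis dec_h : forall i i', ~~ close_times g i i' ->
  \int[m]_z (h (x i z) * h (x i' z)) <= H ^+ 2 + eps.
Hypothesis h_le : forall y, h y <= S.

Let kapxx (i j : nat) (z : Z * Z) := kap (x i z.1, x j z.2).

Let bkapxx i j : bnd_meas (kapxx i j).
Proof.
apply: (bnd_meas_comp (p := fun z : Z * Z => (x i z.1, x j z.2))) => //.
by apply: measurable_fun_pair; apply: measurableT_comp.
Qed.

Let bh : bnd_meas h. Proof. exact: bnd_meas_integral1. Qed.

Let h0 y : 0 <= h y. Proof. exact: bnd_meas_ge0. Qed.

Let H0 : 0 <= H. Proof. by apply: Rintegral_ge0. Qed.

Let bhx i : bnd_meas (fun z => h (x i z)).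
Proof. exact: (bnd_meas_comp (mx i) bh). Qed.

Let S0 : 0 <= S. Proof. exact: le_trans (h0 point) (h_le _). Qed.

Let mean_kapxx i j : \int[(m \x m)%E]_z kapxx i j z = H.
Proof.
rewrite bnd_fubini2//= /H -(law_x j)//; apply: eq_Rintegral => z _.
by rewrite /kapxx/= (law_x i (f := fun a => kap (a, x j z)))//; exact: bnd_meas_ysection.
Qed.

Let kap_hx i i' : \int[m]_z (h (x i z) * h (x i' z)) <= S * H.
Proof.
rewrite /H -(law_x i)// -bnd_integralZl//.
apply: le_bnd_integral => [||z]; first exact: bnd_measM.
  by apply: bnd_measM => //; exact: bnd_meas_cst.
by rewrite mulrC ler_wpM2r.
Qed.

Let far_snd i i' j j' : ~~ close_times g i i' ->
  \int[(m \x m)%E]_z (kapxx i j z * kapxx i' j' z) <=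
  \int[m]_z (h (x j z) * h (x j' z)) + eps.
Proof.
move=> far; rewrite bnd_fubini2; last exact: bnd_measM.
rewrite -[X in _ + X](prob_integral_cst m) -bnd_integralD; last 2 first.
- exact: bnd_measM.
- exact: bnd_meas_cst.
apply: le_bnd_integral => [||z].
- exact: (bnd_meas_integral1 m (bnd_measM (bkapxx i j) (bkapxx i' j'))).
- by apply: bnd_measD; [exact: bnd_measM|exact: bnd_meas_cst].
- by rewrite /kapxx/=; exact: dec_kap.
Qed.

Let far_fst i i' j j' : ~~ close_times g j j' ->
  \int[(m \x m)%E]_z (kapxx i j z * kapxx i' j' z) <=
  \int[m]_z (h (x i z) * h (x i' z)) + eps.
Proof.
move=> far; rewrite bnd_fubini1; last exact: bnd_measM.
rewrite -[X in _ + X](prob_integral_cst m) -bnd_integralD; last 2 first.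
- exact: bnd_measM.
- exact: bnd_meas_cst.
apply: le_bnd_integral => [||z].
- exact: (bnd_meas_integral2 m (bnd_measM (bkapxx i j) (bkapxx i' j'))).
- by apply: bnd_measD; [exact: bnd_measM|exact: bnd_meas_cst].
- rewrite /kapxx/=; apply: le_trans (dec_kap (x i z) (x i' z) far).
  by rewrite le_eqVlt; apply/orP; left; apply/eqP; apply: eq_Rintegral => z' _;
    rewrite kap_sym [kap (x i' z, _)]kap_sym.
Qed.

(* The four terms correspond to which of the pairs of times [i, i'] and [j, j']
   are close. *)
Let second_moment_term i i' j j' :
  \int[(m \x m)%E]_z (kapxx i j z * kapxx i' j' z) <=
  H ^+ 2 + 2 * eps + (S * H) * (close_times g i i')%:R +
  (S * H) * (close_times g j j')%:R +
  H * ((close_times g i i')%:R * (close_times g j j')%:R).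
Proof.
have SH0 : 0 <= S * H by rewrite mulr_ge0.
have H2 : 0 <= H ^+ 2 by rewrite exprn_ge0.
case: (boolP (close_times g i i')) => ci; last first.
  have := far_snd j j' ci.
  case: (boolP (close_times g j j')) => cj /=.
    by have := kap_hx j j'; have := eps0; lra.
  by have := dec_h cj; have := eps0; lra.
case: (boolP (close_times g j j')) => cj /=.
  suff : \int[(m \x m)%E]_z (kapxx i j z * kapxx i' j' z) <= H by have := eps0; lra.
  rewrite -(mean_kapxx i j); apply: le_bnd_integral => //; first exact: bnd_measM.
  by move=> z; rewrite ler_piMr// /kapxx// bnd_meas_ge0.
by have := far_fst i i' cj; have := kap_hx i i'; have := eps0; lra.
Qed.

(** Chebyshev's bound for the number of pairs of points of two independent
   trajectories that the kernel [kap] relates.  Only two-point correlations along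
   a single trajectory are assumed, at times that are not close. *)
Lemma second_moment_hitting n : (0 < n)%N -> 0 < H ->
  ((m \x m) [set z | (\sum_(p : 'I_n * 'I_n) kapxx p.1 p.2 z)%R = 0%R] <=
   (2 * eps / H ^+ 2 + 4 * g%:R * S / (n%:R * H) +
    4 * g%:R ^+ 2 / (n%:R ^+ 2 * H))%:E)%E.
Proof.
move=> n0 Hgt0.
pose s z := \sum_(p : 'I_n * 'I_n) kapxx p.1 p.2 z.
have bs : bnd_meas s by apply: bnd_meas_sum.
pose A := [set z | s z = 0].
have mA : measurable A.
  rewrite (_ : A = setT `&` s @^-1` [set 0]); first exact: bs.1.
  by rewrite setTI.
rewrite -/s -/A (bnd_integral_indic _ mA) lee_fin.
set P := \int[_]_z _.
pose e := n%:R ^+ 2 * H.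
have es : \int[(m \x m)%E]_z s z = e.
  rewrite /s bnd_integral_sum//; under eq_bigr do rewrite mean_kapxx.
  by rewrite sumr_const card_prod card_ord -[LHS]mulr_natl natrM.
have cheb : e ^+ 2 * P + 2 * e * e <= \int[(m \x m)%E]_z (s z * s z) + e ^+ 2.
  have e0 : 0 <= e by rewrite mulr_ge0// exprn_ge0.
  have bA : bnd_meas (\1_A : _ -> R) by exact: bnd_meas_indic.
  have b1 : bnd_meas (fun z => e ^+ 2 * \1_A z).
    by apply: bnd_measM => //; apply: bnd_meas_cst; rewrite exprn_ge0.
  have b2 : bnd_meas (fun z => 2 * e * s z).
    by apply: bnd_measM => //; apply: bnd_meas_cst; rewrite mulr_ge0.
  have b3 : bnd_meas (fun z => s z * s z) by exact: bnd_measM.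
  have b4 : bnd_meas (fun _ : Z * Z => e ^+ 2) by apply: bnd_meas_cst; rewrite exprn_ge0.
  have := le_bnd_integral (m \x m)%E (bnd_measD b1 b2) (bnd_measD b3 b4)
    (@mean_sqr_indic_le R _ s e).
  rewrite !bnd_integralD// prob_integral_cst !bnd_integralZl//.
  by rewrite -/P es.
have ss : \int[(m \x m)%E]_z (s z * s z) <= n%:R ^+ 2 *
    (n%:R ^+ 2 * (H ^+ 2 + 2 * eps) + 4 * n%:R * g%:R * (S * H) + 4 * g%:R ^+ 2 * H).
  have -> : \int[(m \x m)%E]_z (s z * s z) =
      \sum_(p : 'I_n * 'I_n) \sum_(q : 'I_n * 'I_n)
        \int[(m \x m)%E]_z (kapxx p.1 p.2 z * kapxx q.1 q.2 z).
    under eq_Rintegral do rewrite /s big_distrlr/=.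
    rewrite bnd_integral_sum; last first.
      by move=> p; apply: bnd_meas_sum => q; exact: bnd_measM.
    by apply: eq_bigr => p _; rewrite bnd_integral_sum// => q; exact: bnd_measM.
  pose c i i' : R := (close_times g i i')%:R.
  have c0 i i' : 0 <= c i i' by [].
  apply: (@le_trans _ _ (\sum_(p : 'I_n * 'I_n)
      (n%:R ^+ 2 * (H ^+ 2 + 2 * eps) + 4 * n%:R * g%:R * (S * H) + 4 * g%:R ^+ 2 * H))).
    apply: ler_sum => -[i j] _ /=.
    apply: (@le_trans _ _ (\sum_(q : 'I_n * 'I_n)
       (H ^+ 2 + 2 * eps + (S * H) * c i q.1 + (S * H) * c j q.2 +
        H * (c i q.1 * c j q.2)))).
      by apply: ler_sum => -[i' j'] _ /=; exact: second_moment_term.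
    have SH0 : 0 <= S * H by rewrite mulr_ge0.
    have ci := sum_close_times_le R g n i; have cj := sum_close_times_le R g n j.
    set a := \sum_(i' < n) _ in ci; set b := \sum_(i' < n) _ in cj.
    have sa : \sum_(q : 'I_n * 'I_n) c i q.1 = n%:R * a.
      rewrite -(pair_bigA _ (fun i' _ : 'I_n => c i i'))/= exchange_big/=.
      by rewrite sumr_const card_ord mulr_natl.
    have sb : \sum_(q : 'I_n * 'I_n) c j q.2 = n%:R * b.
      rewrite -(pair_bigA _ (fun _ j' : 'I_n => c j j'))/=.
      by rewrite sumr_const card_ord mulr_natl.
    have sab : \sum_(q : 'I_n * 'I_n) (c i q.1 * c j q.2) = a * b.
      by rewrite -(pair_bigA _ (fun i' j' : 'I_n => c i i' * c j j'))/= -big_distrlr.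
    have sk (k : R) : \sum_(q : 'I_n * 'I_n) k = n%:R ^+ 2 * k.
      by rewrite sumr_const card_prod card_ord -[LHS]mulr_natl natrM expr2.
    rewrite !big_split/= -!big_distrr/= sa sb sab !sk.
    have a0 : 0 <= a by apply: sumr_ge0.
    have b0 : 0 <= b by apply: sumr_ge0.
    rewrite natrM in ci cj.
    have nn : 0 <= n%:R :> R by [].
    have na : S * H * (n%:R * a) <= S * H * (n%:R * (2 * g%:R)).
      by rewrite !ler_wpM2l.
    have nb : S * H * (n%:R * b) <= S * H * (n%:R * (2 * g%:R)).
      by rewrite !ler_wpM2l.
    have ab : H * (a * b) <= H * (2 * g%:R * (2 * g%:R)).
      by rewrite ler_wpM2l// ler_pM.
    by lra.
  by rewrite sumr_const card_prod card_ord -[leLHS]mulr_natl natrM expr2.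
by apply: second_moment_arith cheb ss => //; rewrite ltr0n.
Qed.

End second_moment.

(** * Euclidean geometry of the phase space *)

Lemma cauchy_schwarz_sum (R : realDomainType) (I : finType) (a b : I -> R) :
  (\sum_i a i * b i) ^+ 2 <= (\sum_i a i ^+ 2) * (\sum_i b i ^+ 2).
Proof.
rewrite -subr_ge0 -(pmulr_rge0 _ (ltr0n R 2)).
suff -> : 2 * ((\sum_i a i ^+ 2) * (\sum_i b i ^+ 2) - (\sum_i a i * b i) ^+ 2) =
    \sum_i \sum_j (a i * b j - a j * b i) ^+ 2.
  by do 2!(apply: sumr_ge0 => ? _); exact: sqr_ge0.
have -> : \sum_i \sum_j (a i * b j - a j * b i) ^+ 2 =
    \sum_i \sum_j (a i ^+ 2 * b j ^+ 2) + \sum_i \sum_j (b i ^+ 2 * a j ^+ 2)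
    - 2 * \sum_i \sum_j ((a i * b i) * (a j * b j)).
  rewrite big_distrr/= -sumrN -!big_split/=; apply: eq_bigr => i _.
  rewrite big_distrr/= -sumrN -!big_split/=; apply: eq_bigr => j _; ring.
by rewrite -!big_distrlr/= expr2; ring.
Qed.

Section geometry.
Context (R : realType) (N : nat) (X : set 'rV[R]_N) (x0 : X).
Implicit Types (x y z : X) (r : R).

Let cx x (i : 'I_N) : R := set_val x ord0 i.

Lemma eucl_distC x y : eucl_dist x y = eucl_dist y x.
Proof.
by congr Num.sqrt; apply: eq_bigr => i _; rewrite -sqrrN opprB.
Qed.

Lemma eucl_dist_ge0 x y : 0 <= eucl_dist x y.
Proof. exact: sqrtr_ge0. Qed.

Let sqr_eucl_dist x y : eucl_dist x y ^+ 2 = \sum_i (cx x i - cx y i) ^+ 2.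
Proof. by rewrite sqr_sqrtr// sumr_ge0// => i _; exact: sqr_ge0. Qed.

Lemma eucl_dist_triangle y x z : eucl_dist x z <= eucl_dist x y + eucl_dist y z.
Proof.
rewrite -(ler_pXn2r (ltn0Sn 1)) ?nnegrE ?addr_ge0 ?eucl_dist_ge0//.
rewrite sqrrD !sqr_eucl_dist.
have -> : \sum_i (cx x i - cx z i) ^+ 2 = \sum_i (cx x i - cx y i) ^+ 2 +
    2 * \sum_i (cx x i - cx y i) * (cx y i - cx z i) +
    \sum_i (cx y i - cx z i) ^+ 2.
  by rewrite big_distrr/= -!big_split/=; apply: eq_bigr => i _; ring.
rewrite lerD2r lerD2l mulr_natl ler_pMn2r//.
apply: le_trans (ler_norm _) _.
rewrite -(ler_pXn2r (ltn0Sn 1)) ?nnegrE ?mulr_ge0 ?eucl_dist_ge0//.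
by rewrite real_normK ?num_real// exprMn !sqr_eucl_dist cauchy_schwarz_sum.
Qed.

Lemma eucl_dist_lip x y z : `|eucl_dist x z - eucl_dist y z| <= eucl_dist x y.
Proof.
have h1 := eucl_dist_triangle y x z; have h2 := eucl_dist_triangle x y z.
by rewrite ler_norml; rewrite (eucl_distC y x) in h2; lra.
Qed.

Lemma coord_le_eucl_dist x y i : `|cx x i - cx y i| <= eucl_dist x y.
Proof.
rewrite -(ler_pXn2r (ltn0Sn 1)) ?nnegrE ?eucl_dist_ge0//.
rewrite real_normK ?num_real// sqr_eucl_dist (bigD1 i)//= lerDl.
by apply: sumr_ge0 => j _; exact: sqr_ge0.
Qed.

Lemma eucl_dist_le_coord x y (s : R) : 0 <= s ->
  (forall i, `|cx x i - cx y i| <= s) -> eucl_dist x y <= N%:R * s.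
Proof.
move=> s0 H; rewrite -(ler_pXn2r (ltn0Sn 1)) ?nnegrE ?eucl_dist_ge0 ?mulr_ge0//.
rewrite sqr_eucl_dist; apply: (@le_trans _ _ (\sum_(i < N) s ^+ 2)).
  apply: ler_sum => i _; rewrite -real_normK ?num_real//.
  by rewrite ler_pXn2r ?nnegrE.
rewrite sumr_const card_ord -[leLHS]mulr_natl exprMn ler_wpM2r ?sqr_ge0//.
by rewrite -natrX ler_nat; case: N => // n; rewrite leq_pmulr.
Qed.

Lemma measurable_coord i : measurable_fun setT (fun y : borel x0 => cx y i).
Proof.
apply: (measurability _ (RGenOpens.measurableE R)).
move=> _ [_ [a [b ->] <-]]; rewrite setTI; apply: sub_sigma_algebra.
rewrite /opens_at; apply: open_comp; last exact: interval_open.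
move=> y _; apply: (@continuous_comp X 'rV[R]_N R set_val (fun M => M ord0 i)).
  exact: initial_continuous.
exact: coord_continuous.
Qed.

Lemma measurable_eucl_dist :
  measurable_fun setT (fun z : borel x0 * borel x0 => eucl_dist z.1 z.2).
Proof.
have msqrt : measurable_fun setT (Num.sqrt : R -> R).
  by apply: continuous_measurable_fun; exact: sqrt_continuous.
have msum : measurable_fun setT
    (fun z : borel x0 * borel x0 => \sum_i (cx z.1 i - cx z.2 i) ^+ 2).
  apply: measurable_sum => i; apply: measurable_funX; apply: measurable_funB.
    exact: (measurableT_comp (measurable_coord i) measurable_fst).
  exact: (measurableT_comp (measurable_coord i) measurable_snd).
exact: (measurableT_comp msqrt msum).
Qed.

Lemma measurable_dist_lt r :
  measurable [set z : borel x0 * borel x0 | eucl_dist z.1 z.2 < r].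
Proof.
rewrite (_ : mkset _ = setT `&`
    (fun z : borel x0 * borel x0 => eucl_dist z.1 z.2) @^-1` `]-oo, r[%classic).
  exact: measurable_eucl_dist.
by rewrite setTI; apply/seteqP; split => z /=; rewrite in_itv.
Qed.

End geometry.

(** * Smoothed balls and correlation integrals *)

Section smooth_ball.
Context (R : realType) (N : nat) (X : set 'rV[R]_N) (x0 : X).
Implicit Types (x y : X) (r : R).
Local Notation Y := (borel x0).

(** A Lipschitz function of the distance, equal to 1 on the ball of radius
   [r / 2] and to 0 outside the ball of radius [r]. *)
Definition smooth_ball r (z : Y * Y) : R :=
  Num.min 1 (Num.max 0 (2 - 2 / r * eucl_dist z.1 z.2)).

Lemma smooth_ball_ge0 r z : 0 <= smooth_ball r z.
Proof. by rewrite le_min ler01 le_max lexx. Qed.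

Lemma smooth_ball_le1 r z : smooth_ball r z <= 1.
Proof. by rewrite ge_min lexx. Qed.

Lemma smooth_ballC r (a b : Y) : smooth_ball r (a, b) = smooth_ball r (b, a).
Proof. by rewrite /smooth_ball/= eucl_distC. Qed.

Lemma smooth_ball_eq1 r (a b : Y) : 0 < r -> eucl_dist a b < r / 2 ->
  smooth_ball r (a, b) = 1.
Proof.
move=> r0 ab; apply/eqP; rewrite eq_le smooth_ball_le1/= le_min lexx le_max/=.
apply/orP; right; rewrite lerBrDl -lerBrDr (_ : 2 - 1 = 2 / r * (r / 2)); last first.
  by field; rewrite gt_eqF.
by rewrite ler_wpM2l ?divr_ge0 ?ltW.
Qed.

Lemma smooth_ball_eq0 r (a b : Y) : 0 < r -> r <= eucl_dist a b ->
  smooth_ball r (a, b) = 0.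
Proof.
move=> r0 ab; apply/eqP; rewrite eq_le smooth_ball_ge0 andbT ge_min ge_max lexx/=.
apply/orP; right; rewrite subr_le0 [leLHS](_ : 2 = 2 / r * r); last first.
  by field; rewrite gt_eqF.
by rewrite ler_wpM2l// divr_ge0// ltW.
Qed.

Lemma smooth_ball_lip r (a b y : Y) : 0 < r ->
  `|smooth_ball r (a, y) - smooth_ball r (b, y)| <= 2 / r * eucl_dist a b.
Proof.
move=> r0.
have clamp (s t : R) : `|Num.min 1 (Num.max 0 s) - Num.min 1 (Num.max 0 t)| <= `|s - t|.
  rewrite ler_norml !/Num.min !/Num.max.
  have [h1|h1] := leP 0 (s - t); [rewrite (ger0_norm h1)|rewrite (ltr0_norm h1)];
  by repeat case: ifPn; rewrite -?leNgt; move=> *; lra.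
apply: le_trans (clamp _ _) _ => /=.
rewrite (_ : _ - _ = 2 / r * (eucl_dist b y - eucl_dist a y)); last by ring.
rewrite normrM ger0_norm; last by rewrite divr_ge0// ltW.
by rewrite ler_wpM2l ?divr_ge0 ?(ltW r0)// eucl_distC (eucl_distC a) eucl_distC
  (eucl_distC y) (eucl_distC a b) eucl_dist_lip.
Qed.

Lemma bnd_meas_smooth_ball r : bnd_meas (smooth_ball r).
Proof.
split.
  apply: measurable_minr => //; apply: measurable_maxr => //.
  apply: measurable_funB => //; apply: measurable_funM => //.
  exact: measurable_eucl_dist.
by exists 1 => z; rewrite smooth_ball_ge0 smooth_ball_le1.
Qed.

Section measure_of_balls.
Context (nu : probability Y R).

(** The correlation integral: the probability that two independent points with
   law [nu] are at distance less than [r]. *)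
Definition corr_integral r : R :=
  \int[nu]_x \int[nu]_y \1_[set z : Y * Y | eucl_dist z.1 z.2 < r] (x, y).

Let bI r : bnd_meas (\1_[set z : Y * Y | eucl_dist z.1 z.2 < r] : _ -> R).
Proof. by apply: bnd_meas_indic; exact: measurable_dist_lt. Qed.

Lemma corr_integral_ge0 r : 0 <= corr_integral r.
Proof.
by apply: Rintegral_ge0 => x _; apply: Rintegral_ge0 => y _; rewrite indicE.
Qed.

Lemma corr_integralE r :
  (\int[nu]_x nu (eucl_ball (x : X) r))%E = (corr_integral r)%:E.
Proof.
rewrite -bnd_meas_EFin; last exact: (bnd_meas_integral2 nu (bI r)).
apply: eq_integral => x _.
have -> : eucl_ball (x : X) r =
    xsection [set z : Y * Y | eucl_dist z.1 z.2 < r] x.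
  by apply/seteqP; split => y; rewrite /xsection/eucl_ball/= inE.
rewrite (bnd_integral_indic nu); last first.
  by apply: measurable_xsection; exact: measurable_dist_lt.
congr EFin; apply: eq_Rintegral => y _.
by rewrite !indicE mem_xsection.
Qed.

(** The measure of the ball of radius [r] around [y], up to smoothing. *)
Definition smooth_measure r (y : Y) : R := \int[nu]_a smooth_ball r (a, y).

(** The smoothed correlation integral. *)
Definition smooth_corr r : R := \int[nu]_y smooth_measure r y.

Lemma bnd_meas_smooth_measure r : bnd_meas (smooth_measure r).
Proof. exact: (bnd_meas_integral1 nu (bnd_meas_smooth_ball r)). Qed.

Let bsec r y : bnd_meas (fun a => smooth_ball r (a, y)).
Proof. exact: (bnd_meas_ysection (bnd_meas_smooth_ball r)). Qed.

Lemma smooth_measure_ge0 r y : 0 <= smooth_measure r y.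
Proof. exact: bnd_meas_ge0 (bnd_meas_smooth_measure r) y. Qed.

Lemma smooth_measure_le1 r y : smooth_measure r y <= 1.
Proof. by apply: bnd_integral_le1 => // a; exact: smooth_ball_le1. Qed.

Lemma smooth_measure_lip r (y y' : Y) : 0 < r ->
  `|smooth_measure r y - smooth_measure r y'| <= 2 / r * eucl_dist y y'.
Proof.
move=> r0; set l := _ * _.
have l0 : 0 <= l by rewrite mulr_ge0 ?eucl_dist_ge0// divr_ge0// ltW.
have half u u' : eucl_dist u u' = eucl_dist y y' ->
    smooth_measure r u <= smooth_measure r u' + l.
  move=> uu'; rewrite -[X in _ + X](prob_integral_cst nu) -bnd_integralD//; last first.
    exact: bnd_meas_cst.
  apply: le_bnd_integral => // [|a].
    by apply: bnd_measD => //; exact: bnd_meas_cst.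
  have := smooth_ball_lip u u' a r0; rewrite uu' -/l smooth_ballC (smooth_ballC _ u').
  by move/ler_normlW; lra.
have h1 := half y y' erefl; have h2 := half y' y (eucl_distC _ _).
by rewrite ler_norml; lra.
Qed.

Lemma corr_integral_le_smooth r : 0 < r -> corr_integral (r / 2) <= smooth_corr r.
Proof.
move=> r0; apply: le_bnd_integral => [||y].
- exact: (bnd_meas_integral2 nu (bI _)).
- exact: bnd_meas_smooth_measure.
apply: le_bnd_integral => // [|a]; first exact: (bnd_meas_xsection (bI _)).
rewrite indicE; case: (boolP (_ \in _)) => [|_]; last exact: smooth_ball_ge0.
by rewrite inE/= => ya; rewrite smooth_ball_eq1// eucl_distC.
Qed.

(** A measurable set of small diameter has measure at most the square root of
   the correlation integral: two independent points may both fall into it. *)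
Lemma sqr_measure_le_smooth_corr r (C : set Y) : 0 < r -> measurable C ->
  (forall a b : Y, C a -> C b -> eucl_dist a b < r / 2) ->
  (\int[nu]_a \1_C a) ^+ 2 <= smooth_corr r.
Proof.
move=> r0 mC Cr; set p := \int[nu]_a \1_C a.
have bC : bnd_meas (\1_C : Y -> R) by exact: bnd_meas_indic.
have p0 : 0 <= p by apply: Rintegral_ge0 => a _; rewrite indicE.
rewrite expr2 -{2}/p /p -bnd_integralZl// -/p.
apply: le_bnd_integral => [||y]; last first.
- rewrite mulrC /p -bnd_integralZl//; apply: le_bnd_integral => // [|a].
    by apply: bnd_measM => //; apply: bnd_meas_cst; rewrite indicE.
  rewrite !indicE; case: (boolP (y \in C)) => /=; rewrite ?mul0r ?smooth_ball_ge0//.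
  case: (boolP (a \in C)) => /=; rewrite ?mulr0 ?smooth_ball_ge0// !inE => Ca Cy.
  by rewrite mulr1 smooth_ball_eq1//; exact: Cr.
- exact: bnd_meas_smooth_measure.
- by apply: bnd_measM => //; exact: bnd_meas_cst.
Qed.

(** The number of cells of side [r / (2 * N + 1)] in a cube of side [2 * r]. *)
Definition cell_count : nat := #|{ffun 'I_N -> 'I_(2 * (2 * N).+1)}|.

(** The ball is cut into a bounded number of cells of diameter less than
   [r / 2]. *)
Lemma smooth_measure_le_sqrt r y : 0 < r ->
  smooth_measure r y <= cell_count%:R * Num.sqrt (smooth_corr r).
Proof.
move=> r0.
pose k := (2 * N).+1; pose s := r / k%:R.
have k0 : 0 < k%:R :> R by rewrite ltr0n.
have s0 : 0 < s by rewrite divr_gt0.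
pose lo (i : 'I_N) (c : 'I_(2 * k)) : R := set_val (y : X) ord0 i + (c%:R - k%:R) * s.
pose cell (f : {ffun 'I_N -> 'I_(2 * k)}) : set Y := \bigcap_(i in setT)
  [set a | lo i (f i) <= set_val (a : X) ord0 i < lo i (f i) + s].
have mcell f : measurable (cell f).
  apply: fin_bigcap_measurable => [|i _]; first exact: finite_finset.
  have := measurable_coord (x0 := x0) i measurableT
    (measurable_itv `[lo i (f i), lo i (f i) + s[).
  by rewrite setTI.
have bcell f : bnd_meas (\1_(cell f) : Y -> R) by exact: bnd_meas_indic.
have diam f a b : cell f a -> cell f b -> eucl_dist a b < r / 2.
  move=> fa fb; apply: (@le_lt_trans _ _ (N%:R * s)).
    apply: eucl_dist_le_coord => [|i]; first exact: ltW.
    have /andP[a1 a2] := fa i I; have /andP[b1 b2] := fb i I.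
    by rewrite ler_norml; lra.
  (* [N * s < r / 2], as [s = r / (2 * N + 1)]. *)
  rewrite /s mulrCA ltr_pM2l// ltr_pdivrMr// mulrC ltr_pdivlMr// -natrM ltr_nat.
  by rewrite /k mulnC.
have cover a : smooth_ball r (a, y) <= \sum_f \1_(cell f) a.
  have [ry|ay] := leP r (eucl_dist a y).
    by rewrite smooth_ball_eq0//; apply: sumr_ge0 => f _; rewrite indicE.
  have t_itv i : 0 <= (set_val (a : X) ord0 i - set_val (y : X) ord0 i) / s + k%:R
      < (2 * k)%:R.
    have := le_lt_trans (coord_le_eucl_dist (a : X) (y : X) i) ay.
    rewrite (_ : r = k%:R * s); last by rewrite /s mulrC divfK// gt_eqF.
    rewrite ltr_norml -mulNr -ltr_pdivlMr// -[X in _ && X]ltr_pdivrMr// => /andP[h1 h2].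
    by rewrite natrM; apply/andP; split; lra.
  (* Inside the ball the rescaled coordinate lies in [0, 2 * k), so its integer
     part is a genuine index. *)
  pose f : {ffun 'I_N -> 'I_(2 * k)} := [ffun i => inord (Num.truncn
    ((set_val (a : X) ord0 i - set_val (y : X) ord0 i) / s + k%:R))].
  have fa : cell f a.
    move=> i _ /=; rewrite /lo ffunE; have /andP[t0 t1] := t_itv i.
    have /andP[c1 c2] := truncn_itv t0.
    rewrite inordK; last by rewrite ltnS -ltnS truncn_lt_nat.
    set c := (Num.truncn _)%:R in c1 *; rewrite -natr1 -/c in c2.
    rewrite -lerBlDr ler_pdivlMr// in c1; rewrite -ltrBrDr ltr_pdivrMr// in c2.
    by apply/andP; split; lra.
  rewrite (bigD1 f)//= [X in X + _]indicE mem_set//= (le_trans (smooth_ball_le1 _ _))//.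
  by rewrite lerDl; apply: sumr_ge0 => g _; rewrite indicE.
apply: (@le_trans _ _ (\int[nu]_a \sum_f \1_(cell f) a)).
  by apply: le_bnd_integral => //; exact: bnd_meas_sum.
rewrite bnd_integral_sum// /cell_count -sum1_card natr_sum mulr_suml.
apply: ler_sum => f _; rewrite mul1r.
have p0 : 0 <= \int[nu]_a (\1_(cell f) a : R).
  by apply: Rintegral_ge0 => a _; rewrite indicE.
rewrite -(ger0_norm p0) -sqrtr_sqr ler_wsqrtr//.
by apply: sqr_measure_le_smooth_corr => // a b; exact: diam.
Qed.

End measure_of_balls.
End smooth_ball.

(** * Orbits of the random dynamical system *)

Section holder.
Context (R : realType) (N : nat) (X : set 'rV[R]_N) (x0 : X).

(** A function with values in [0, 1] and Lipschitz constant [L >= 1] is Hoelder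
   for every exponent: [min 1 (L * d) <= (L * d) ^ alpha <= L * d ^ alpha]. *)
Lemma holder_norm_lip (alpha L : R) (psi : X -> R) :
  0 < alpha <= 1 -> 1 <= L -> (forall x, 0 <= psi x <= 1) ->
  (forall x y, `|psi x - psi y| <= L * eucl_dist x y) ->
  (0 <= holder_norm alpha psi <= (1 + L)%:E)%E.
Proof.
move=> /andP[a0 a1] L1 psi01 psiL.
have L0 : 0 <= L by exact: le_trans L1.
apply/andP; split.
  apply: adde_ge0; last by rewrite le_max lexx.
  apply: (@le_trans _ _ `|psi x0|%:E); first by rewrite lee_fin.
  by apply: ereal_sup_ubound; exists x0.
rewrite EFinD; apply: leeD.
  apply: ge_ereal_sup => _ [x _ <-]; rewrite lee_fin.
  by have /andP[h0 h1] := psi01 x; rewrite ger0_norm.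
rewrite ge_max lee_fin L0/=; apply: ge_ereal_sup => _ [[x y] /= _ <-].
rewrite lee_fin; have [d0|d0] := eqVneq (eucl_dist x y `^ alpha) 0.
  by rewrite d0 invr0 mulr0.
have dgt0 : 0 < eucl_dist x y `^ alpha by rewrite lt_neqAle eq_sym d0 powR_ge0.
rewrite ler_pdivrMr//.
have diff1 : `|psi x - psi y| <= 1.
  by have := psi01 x; have := psi01 y; rewrite ler_norml; lra.
have De := eucl_dist_ge0 x y.
apply: (@le_trans _ _ ((L * eucl_dist x y) `^ alpha)); last first.
  by rewrite powRM// ler_wpM2r ?powR_ge0// ler1_powR.
have [le1|gt1] := leP (L * eucl_dist x y) 1.
  apply: le_trans (psiL x y) _.
  have [->|ne0] := eqVneq (L * eucl_dist x y) 0; first exact: powR_ge0.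
  by apply: ger1_powR => //; rewrite lt_neqAle eq_sym ne0 mulr_ge0.
by apply: le_trans diff1 _; rewrite -(powRr0 (L * eucl_dist x y)) ler_powR// ltW.
Qed.

End holder.

Section orbits.
Context (R : realType) (N : nat) (Omega : topologicalType) (w0 : Omega).
Context (X : set 'rV[R]_N) (x0 : X) (P : probability (borel w0) R).
Context (theta : Omega -> Omega) (T : Omega -> X -> X).
Context (mu : probability (borel w0 * borel x0)%type R).
Local Notation Y := (borel x0).
Local Notation Z := (borel w0 * borel x0)%type.
Local Notation nu := (marginal mu).
Let S : Z -> Z := skew_product theta T.

(** The [n]-th point of the random orbit started at [z]. *)
Definition orbit_pt (n : nat) (z : Z) : Y := rds_iter theta T n z.1 z.2.

Let iter_skewE n z : iter n S z = (iter n theta z.1, orbit_pt n z).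
Proof. by elim: n => [|n IH] /=; [case: z|rewrite IH]. Qed.

Let orbit_ptE n : orbit_pt n = @proj_X _ _ _ w0 _ x0 \o iter n S.
Proof. by apply/funext => z /=; rewrite iter_skewE. Qed.

Let orbit_pt_shift k n z : orbit_pt (k + n) z = orbit_pt k (iter n S z).
Proof. by rewrite !orbit_ptE /= iterD. Qed.

Section invariant.
Hypothesis inv : rds_invariant P theta T mu.

Let measurable_iter n : measurable_fun setT (iter n S).
Proof.
elim: n => [|n IH]; first exact: measurable_id.
exact: (measurableT_comp inv.1.1 IH).
Qed.

Let iter_invariant n A : measurable A -> pushforward mu (iter n S) A = mu A.
Proof.
elim: n A => [//|n IH] A mA; rewrite -[RHS]inv.1.2//.
have mSA : measurable (S @^-1` A).
  by rewrite -[X in measurable X]setTI; exact: inv.1.1.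
exact: IH mSA.
Qed.

Let integral_iter n (f : Z -> R) : bnd_meas f ->
  \int[mu]_z f (iter n S z) = \int[mu]_z f z.
Proof.
by apply: bnd_integral_pushforward; [exact: measurable_iter|exact: iter_invariant].
Qed.

Let integral_proj (f : Y -> R) : bnd_meas f ->
  \int[mu]_z f z.2 = \int[nu]_y f y.
Proof.
by apply: bnd_integral_pushforward => // A mA; exact: measurable_snd.
Qed.

Lemma measurable_orbit_pt n : measurable_fun setT (orbit_pt n).
Proof.
rewrite orbit_ptE; apply: (measurableT_comp _ (measurable_iter n)).
exact: measurable_snd.
Qed.

Lemma integral_orbit_pt n (f : Y -> R) : bnd_meas f ->
  \int[mu]_z f (orbit_pt n z) = \int[nu]_y f y.
Proof.
move=> bf; rewrite orbit_ptE -(integral_proj bf).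
have b2 : bnd_meas (fun z : Z => f z.2).
  exact: (bnd_meas_comp measurable_snd bf).
by rewrite -(integral_iter n b2).
Qed.

Section decay.
Context (alpha L : R).
Hypothesis alpha01 : 0 < alpha <= 1.
Hypothesis L1 : 1 <= L.
Hypothesis dec : annealed_decay alpha theta T mu.
Variables psi phi : Y -> R.
Hypothesis bpsi : bnd_meas psi.
Hypothesis bphi : bnd_meas phi.
Hypothesis psi01 : forall y, 0 <= psi y <= 1.
Hypothesis phi01 : forall y, 0 <= phi y <= 1.
Hypothesis psiL : forall a b : Y, `|psi a - psi b| <= L * eucl_dist a b.
Hypothesis phiL : forall a b : Y, `|phi a - phi b| <= L * eucl_dist a b.

Let decay0 n : (0 < n)%N ->
  \int[mu]_z (psi (orbit_pt n z) * phi (orbit_pt 0 z)) <=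
  (\int[nu]_y psi y) * (\int[nu]_y phi y) + (1 + L) ^+ 2 * expR (- n%:R).
Proof.
move=> n0.
have /andP[psi0 psi_le] := holder_norm_lip x0 alpha01 L1 psi01 psiL.
have /andP[phi0 phi_le] := holder_norm_lip x0 alpha01 L1 phi01 phiL.
have := dec n0 (le_lt_trans psi_le (ltry _)) (le_lt_trans phi_le (ltry _)).
have bp : bnd_meas (fun z : Z => psi (orbit_pt n z) * phi z.2).
  apply: bnd_measM; first exact: (bnd_meas_comp (measurable_orbit_pt n) bpsi).
  exact: (bnd_meas_comp measurable_snd bphi).
have b2 (f : Y -> R) : bnd_meas f -> bnd_meas (fun z : Z => f z.2).
  by move=> bf; exact: (bnd_meas_comp measurable_snd bf).
rewrite (bnd_meas_EFin mu bp) (bnd_meas_EFin mu (b2 _ bpsi)).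
rewrite (bnd_meas_EFin mu (b2 _ bphi)) !integral_proj// => H.
have {H} : (`|\int[mu]_z (psi (orbit_pt n z) * phi z.2) -
    (\int[nu]_y psi y) * (\int[nu]_y phi y)|%:E <=
    ((1 + L) ^+ 2 * expR (- n%:R))%:E)%E.
  apply: le_trans H _; rewrite EFinM; apply: lee_pmul => //.
  - by rewrite mule_ge0.
  - by rewrite expr2 EFinM; apply: lee_pmul.
by rewrite lee_fin => /ler_normlW; rewrite -lerBlDl.
Qed.

(** By invariance, the decay of correlations holds for any two times along the
   orbit. *)
Lemma decay_orbit_pt g n k : (0 < g)%N -> (n + g <= k)%N ->
  \int[mu]_z (psi (orbit_pt k z) * phi (orbit_pt n z)) <=
  (\int[nu]_y psi y) * (\int[nu]_y phi y) + (1 + L) ^+ 2 * expR (- g%:R).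
Proof.
move=> g0 gk; have kE : k = (k - n + n)%N by rewrite subnK//; lia.
have -> : \int[mu]_z (psi (orbit_pt k z) * phi (orbit_pt n z)) =
    \int[mu]_z (psi (orbit_pt (k - n) z) * phi (orbit_pt 0 z)).
  rewrite -(integral_iter n (f := fun z => psi (orbit_pt (k - n) z) * phi (orbit_pt 0 z))).
    apply: eq_Rintegral => z _.
    by rewrite -!orbit_pt_shift subnK ?add0n//; lia.
  apply: bnd_measM; first exact: (bnd_meas_comp (measurable_orbit_pt _) bpsi).
  exact: (bnd_meas_comp (measurable_orbit_pt _) bphi).
apply: le_trans (decay0 _) _; first by lia.
rewrite lerD2l ler_wpM2l ?sqr_ge0// ler_expR lerN2 ler_nat; lia.
Qed.

End decay.

(** The number of pairs of times before [n] at which two orbits are at distance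
   less than [r]. *)
Definition hit_count (n : nat) (r : R) (z : Z * Z) : R :=
  \sum_(p : 'I_n * 'I_n) \1_[set a : Y * Y | eucl_dist a.1 a.2 < r]
    (orbit_pt p.1 z.1, orbit_pt p.2 z.2).

Let bI r : bnd_meas (\1_[set z : Y * Y | eucl_dist z.1 z.2 < r] : _ -> R).
Proof. by apply: bnd_meas_indic; exact: measurable_dist_lt. Qed.

Let bhit n r (p : 'I_n * 'I_n) : bnd_meas (fun z : Z * Z =>
  \1_[set a : Y * Y | eucl_dist a.1 a.2 < r]
    (orbit_pt p.1 z.1, orbit_pt p.2 z.2) : R).
Proof.
apply: (bnd_meas_comp (p := fun z : Z * Z => (orbit_pt p.1 z.1, orbit_pt p.2 z.2)))
  => //.
apply: measurable_fun_pair.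
  exact: (measurableT_comp (measurable_orbit_pt _) measurable_fst).
exact: (measurableT_comp (measurable_orbit_pt _) measurable_snd).
Qed.

(** The pairs of initial conditions whose orbits come within [r] of each other
   before time [n]. *)
Definition hit_set n r : set (Z * Z) := [set z | 1 <= hit_count n r z].

Lemma measurable_hit_set n r : measurable (hit_set n r).
Proof.
have bh : bnd_meas (hit_count n r) by apply: bnd_meas_sum => p; exact: bhit.
rewrite (_ : hit_set n r = setT `&` hit_count n r @^-1` `[1, +oo[%classic).
  exact: bh.1.
by rewrite setTI; apply/seteqP; split => z /=; rewrite in_itv/= andbT.
Qed.

(** The union bound over pairs of times. *)
Lemma hit_prob_le n r :
  ((mu \x mu)%E (hit_set n r) <=
   (n%:R ^+ 2 * corr_integral nu r)%:E)%E.
Proof.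
have bh : bnd_meas (hit_count n r) by apply: bnd_meas_sum => p; exact: bhit.
rewrite (bnd_integral_indic _ (measurable_hit_set n r)) lee_fin.
apply: (@le_trans _ _ (\int[(mu \x mu)%E]_z hit_count n r z)).
  apply: le_bnd_integral => // [|z].
    by apply: bnd_meas_indic; exact: measurable_hit_set.
  rewrite indicE; case: (boolP (z \in _)) => [|_]; first by rewrite inE.
  exact: bnd_meas_ge0.
rewrite bnd_integral_sum//.
rewrite (eq_bigr (fun _ => corr_integral nu r)) => [|p _].
  by rewrite sumr_const card_prod card_ord -[leLHS]mulr_natl natrM expr2.
rewrite bnd_fubini1; last exact: bhit.
rewrite /corr_integral -(integral_orbit_pt p.1); last first.
  exact: (bnd_meas_integral2 nu (bI r)).
apply: eq_Rintegral => z _ /=.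
by rewrite -(integral_orbit_pt p.2)//; exact: (bnd_meas_xsection (bI r)).
Qed.

End invariant.

Lemma shortest_dist_ltP n (z : Z * Z) (r : R) :
  (shortest_dist theta T n z.1.1 z.2.1 z.1.2 z.2.2 < r%:E)%E <->
  exists i j : 'I_n, eucl_dist (orbit_pt i z.1) (orbit_pt j z.2) < r.
Proof.
split.
  move=> /bigmin_ltP[|[i _]]; first by rewrite ltNge leey.
  move=> /bigmin_ltP[|[j _]]; first by rewrite ltNge leey.
  by rewrite lte_fin => ij; exists i, j.
move=> [i [j ij]]; apply/bigmin_ltP; right; exists i => //.
by apply/bigmin_ltP; right; exists j => //; rewrite lte_fin.
Qed.

Lemma shortest_dist_ge0 n w w' x x' : (0 <= shortest_dist theta T n w w' x x')%E.
Proof.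
apply: le_bigmin; first exact: leey.
move=> i _; apply: le_bigmin; first exact: leey.
by move=> j _; rewrite lee_fin eucl_dist_ge0.
Qed.

Lemma shortest_dist_dec m n w w' x x' : (m <= n)%N ->
  (shortest_dist theta T n w w' x x' <= shortest_dist theta T m w w' x x')%E.
Proof.
move=> mn; apply: le_bigmin; first exact: bigmin_le_id.
move=> i _; apply: le_bigmin.
  exact: leey.
move=> j _; apply: (@bigmin_inf _ _ _ _ (widen_ord mn i)) => //.
exact: (@bigmin_inf _ _ _ _ (widen_ord mn j)).
Qed.

End orbits.

(** * Limits and almost sure limits in the extended reals *)

Lemma ereal_dense (R : realType) (x y : \bar R) :
  (x < y)%E -> exists c : R, (x < c%:E < y)%E.
Proof.
case: x => [x||]; case: y => [y||] //=; rewrite ?lte_fin => xy.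
- by exists ((x + y) / 2); rewrite !lte_fin; lra.
- by exists (x + 1); rewrite lte_fin ltry; lra.
- by exists (y - 1); rewrite lte_fin ltNyr; lra.
- by exists 0; rewrite ltNyr ltry.
Qed.

Section limf_cvg.
Context (T : choiceType) (X : filteredType T) (R : realType).
Context (F : set_system X) {FF : ProperFilter F}.
Implicit Types (f : X -> \bar R).

Lemma limf_einf_le_esup f : (limf_einf f F <= limf_esup f F)%E.
Proof.
rewrite leNgt; apply/negP => /ereal_dense[c /andP[supc cinf]].
have Fc : F ([set x | (f x < c%:E)%E] `&` [set x | (c%:E < f x)%E]).
  by apply: filterI; [exact: limf_esup_lt|exact: limf_einf_gt].
by have [x [/= /ltW h1]] := filter_ex Fc; rewrite ltNge h1.
Qed.

Lemma cvg_limf_einf_esup f (C : \bar R) : f x @[x --> F] --> C ->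
  limf_einf f F = C /\ limf_esup f F = C.
Proof.
move=> fC.
have supC : (limf_esup f F <= C)%E.
  rewrite leNgt; apply/negP => /ereal_dense[c /andP[Cc]].
  rewrite ltNge => /negP; apply; apply: limf_esup_le.
  have Fc : F (f @^-1` [set u | (u < c%:E)%E]) by apply: fC; exact: open_ereal_lt'.
  by apply: filterS Fc => x /ltW.
have infC : (C <= limf_einf f F)%E.
  rewrite leNgt; apply/negP => /ereal_dense[c /andP[]].
  rewrite ltNge => /negP h cC; apply: h; apply: limf_einf_ge.
  have Fc : F (f @^-1` [set u | (c%:E < u)%E]) by apply: fC; exact: open_ereal_gt'.
  by apply: filterS Fc => x /ltW.
have h := limf_einf_le_esup f.
by split; apply/eqP; rewrite eq_le ?infC ?supC ?(le_trans h)// (le_trans _ h).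
Qed.

End limf_cvg.

Lemma cvg_of_limn_einf_esup (R : realType) (u : nat -> \bar R) (l : \bar R) :
  (l <= limn_einf u)%E -> (limn_esup u <= l)%E -> u n @[n --> \oo] --> l.
Proof.
move=> h1 h2; have h3 := limn_einf_sup u.
have E1 : limn_einf u = l.
  by apply/eqP; rewrite eq_le h1 (le_trans h3).
have E2 : limn_esup u = l.
  by apply/eqP; rewrite eq_le h2 -{1}E1.
apply: (@squeeze_cvge _ _ _ _ (einfs u) u (esups u)).
- apply: nearW => n; apply/andP; split.
    by apply: ereal_inf_lbound; exists n => /=.
  by apply: ereal_sup_ubound; exists n => /=.
- by rewrite -E1 limn_einf_lim; exact: is_cvg_einfs.
- by rewrite -E2 limn_esup_lim; exact: is_cvg_esups.
Qed.

Section ae_limn.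
Context d (T : measurableType d) (R : realType) (m : {measure set T -> \bar R}).
Implicit Types (u : T -> nat -> \bar R) (t : R).

Let small (e : R) : 0 < e -> exists j : nat, j.+1%:R^-1 < e.
Proof.
move=> e0; exists (Num.truncn e^-1); rewrite -[ltRHS]invrK ltf_pV2 ?posrE ?invr_gt0//.
exact: truncnS_gt.
Qed.

Lemma ae_limn_esup_le u t :
  (forall k, t < k -> {ae m, forall z, \forall n \near \oo, (u z n <= k%:E)%E}) ->
  {ae m, forall z, (limn_esup (u z) <= t%:E)%E}.
Proof.
move=> H.
have : {ae m, forall z, forall j : nat, \forall n \near \oo,
    (u z n <= (t + j.+1%:R^-1)%:E)%E}.
  by apply: ae_foralln => j; apply: H; rewrite ltrDl invr_gt0.
apply: filterS => z Hz; apply/lee_addgt0Pr => e /small[j je].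
apply: (@le_trans _ _ (t + j.+1%:R^-1)%:E); last by rewrite -EFinD lee_fin lerD2l ltW.
exact: limf_esup_le (Hz j).
Qed.

Lemma ae_limn_einf_ge u t :
  (forall k, k < t -> {ae m, forall z, \forall n \near \oo, (k%:E <= u z n)%E}) ->
  {ae m, forall z, (t%:E <= limn_einf (u z))%E}.
Proof.
move=> H.
have : {ae m, forall z, forall j : nat, \forall n \near \oo,
    ((t - j.+1%:R^-1)%:E <= u z n)%E}.
  by apply: ae_foralln => j; apply: H; rewrite gtrBl invr_gt0.
apply: filterS => z Hz; apply/lee_subgt0Pr => e /small[j je].
apply: (@le_trans _ _ (t - j.+1%:R^-1)%:E); first by rewrite -EFinB lee_fin lerB// ltW.
exact: limf_einf_ge (Hz j).
Qed.

End ae_limn.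

(** * Geometric bounds *)

Section geometric_bounds.
Context (R : realType).
Implicit Types (a b c k r s : R).

Lemma powR_exprn b c l : 0 <= b -> (b ^+ l) `^ c = (b `^ c) ^+ l.
Proof.
by move=> b0; rewrite -powR_mulrn// powRAC powR_mulrn// powR_ge0.
Qed.

Lemma powR2_lt1 c : c < 0 -> 2 `^ c < 1 :> R.
Proof.
by move=> c0; rewrite /powR gt_eqF// expR_lt1 pmulr_llt0// ln_gt0// ltr1n.
Qed.

Lemma exprn_lt_eventually b r : 0 <= b < 1 -> 0 < r ->
  exists l0, forall l, (l0 <= l)%N -> b ^+ l < r.
Proof.
move=> /andP[b0 b1] r0; have b1' : `|b| < 1 by rewrite ger0_norm.
have /cvgrPdist_lt/(_ r r0)[l0 _ H] := cvg_expr b1'.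
exists l0 => l /H /=; rewrite sub0r normrN ger0_norm//; exact: exprn_ge0.
Qed.

Lemma bernoulli_le c l : 0 <= c -> 1 + l%:R * c <= (1 + c) ^+ l.
Proof.
move=> c0; elim: l => [|l IH]; first by rewrite mul0r addr0 expr0.
rewrite exprS; apply: le_trans (ler_wpM2l _ IH); last by rewrite addr_ge0.
rewrite -natr1; have : 0 <= l%:R * (c * c) by rewrite !mulr_ge0.
lra.
Qed.

(** A linear factor only slightly increases the ratio of a geometric
   sequence. *)
Lemma linear_geometric_le s r (A : nat) : 0 < s -> s < r ->
  exists2 B : R, 0 <= B & forall l, (A * l + 1)%:R * s ^+ l <= B * r ^+ l.
Proof.
move=> s0 sr; pose h := r / s - 1.
have h0 : 0 < h by rewrite subr_gt0 ltr_pdivlMr// mul1r.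
have B0 : 0 <= A%:R / h + 1 by rewrite addr_ge0// divr_ge0// ltW.
exists (A%:R / h + 1) => // l.
have -> : r ^+ l = (1 + h) ^+ l * s ^+ l.
  by rewrite -exprMn; congr (_ ^+ l); rewrite /h; field; rewrite gt_eqF.
rewrite mulrA ler_pM2r ?exprn_gt0//.
apply: le_trans (ler_wpM2l B0 (bernoulli_le l (ltW h0))).
rewrite natrD natrM.
have -> : (A%:R / h + 1) * (1 + l%:R * h) = A%:R * l%:R + 1 + (A%:R / h + l%:R * h).
  by field; rewrite gt_eqF.
by rewrite lerDl addr_ge0// ?divr_ge0 ?mulr_ge0// ltW.
Qed.

(** The bound of the second moment estimate decays geometrically along
   [n = 2 ^ l], [r = b ^ l], with a correlation gap [A * l + 1] that makes the
   error term [exp (- g)] beat every exponential loss; here [u] stands for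
   [1 / (n * sqrt H)], with [H] the smoothed correlation integral. *)
Lemma second_moment_geometric a K s b : 0 <= a -> 0 <= K -> 0 < s < 1 -> 0 < b ->
  exists A : nat, exists D q, [/\ 0 <= D, 0 < q < 1 & forall l u,
    0 <= u -> u <= a * s ^+ l ->
    2 * ((4 / b ^+ l) ^+ 2 * expR (- (A * l + 1)%:R)) * ((2 ^+ l) ^+ 4 * u ^+ 4) +
    4 * (A * l + 1)%:R * K * u + 4 * ((A * l + 1)%:R * u) ^+ 2 <= D * q ^+ l].
Proof.
move=> a0 K0 /andP[s0 s1] b0.
pose q := (1 + s) / 2.
have q0 : 0 < q by rewrite /q; lra.
have q1 : q < 1 by rewrite /q; lra.
have sq : s < q by rewrite /q; lra.
(* [exp (- A) <= b ^ 2 / 32], so that [16 * b ^ (- 2) * exp (- A) <= 1 / 2]. *)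
pose A := (Num.truncn (ln (32 / b ^+ 2))).+1.
have [B B0 BP] := linear_geometric_le A s0 sq.
exists A, (32 * a ^+ 4 + 4 * K * (B * a) + 4 * (B * a) ^+ 2), q.
split.
- by rewrite !addr_ge0// !mulr_ge0// ?exprn_ge0// mulr_ge0.
- by rewrite q0.
move=> l u u0 ul.
have sl0 : 0 <= s ^+ l by rewrite exprn_ge0// ltW.
have ql0 : 0 <= q ^+ l by rewrite exprn_ge0// ltW.
have gu : (A * l + 1)%:R * u <= B * a * q ^+ l.
  apply: (@le_trans _ _ (a * ((A * l + 1)%:R * s ^+ l))).
    by rewrite mulrCA ler_wpM2l.
  by rewrite [leRHS]mulrAC [leRHS]mulrC ler_wpM2l.
have gu0 : 0 <= (A * l + 1)%:R * u by rewrite mulr_ge0.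
have t2 : 4 * (A * l + 1)%:R * K * u <= 4 * K * (B * a) * q ^+ l.
  rewrite (_ : 4 * (A * l + 1)%:R * K * u = 4 * K * ((A * l + 1)%:R * u)); last by ring.
  by rewrite -[leRHS]mulrA ler_wpM2l// mulr_ge0.
have t3 : 4 * ((A * l + 1)%:R * u) ^+ 2 <= 4 * (B * a) ^+ 2 * q ^+ l.
  rewrite -mulrA ler_wpM2l//.
  apply: (@le_trans _ _ ((B * a * q ^+ l) ^+ 2)).
    by rewrite ler_pXn2r ?nnegrE// mulr_ge0// mulr_ge0.
  rewrite exprMn ler_wpM2l ?exprn_ge0 ?mulr_ge0// expr2 ler_piMr//.
  by rewrite exprn_ile1// ltW.
suff t1 : 2 * ((4 / b ^+ l) ^+ 2 * expR (- (A * l + 1)%:R)) *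
    ((2 ^+ l) ^+ 4 * u ^+ 4) <= 32 * a ^+ 4 * q ^+ l.
  rewrite [leRHS]mulrDl [X in _ <= X + _]mulrDl.
  by apply: lerD => //; apply: lerD.
have u4 : u ^+ 4 <= a ^+ 4.
  rewrite ler_pXn2r ?nnegrE//; apply: le_trans ul _.
  by rewrite ler_piMr// exprn_ile1// ltW.
have eA : expR (- (A * l + 1)%:R) <= (b ^+ 2 / 32) ^+ l :> R.
  have x0 : 0 < 32 / b ^+ 2 by rewrite divr_gt0// exprn_gt0.
  have -> : b ^+ 2 / 32 = expR (- ln (32 / b ^+ 2)).
    by rewrite expRN lnK ?posrE// invf_div.
  rewrite -expRM_natl ler_expR mulrN lerN2 natrD natrM.
  apply: (@le_trans _ _ (A%:R * l%:R)); last by rewrite lerDl.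
  by rewrite mulrC ler_wpM2r// ltW// truncnS_gt.
have lhs : 2 * ((4 / b ^+ l) ^+ 2 * (b ^+ 2 / 32) ^+ l) * ((2 ^+ l) ^+ 4 * a ^+ 4) =
    32 * a ^+ 4 * (2^-1) ^+ l.
  have bl : b ^+ l != 0 by rewrite expf_neq0// gt_eqF.
  rewrite !expr_div_n -!exprM [(2 * l)%N]mulnC !exprM.
  have -> : (2^-1) ^+ l = (2 ^+ l) ^+ 4 / 32 ^+ l :> R.
    rewrite -exprM mulnC exprM -expr_div_n; congr (_ ^+ l); by field.
  by field; rewrite bl expf_neq0.
apply: (@le_trans _ _ (32 * a ^+ 4 * (2^-1) ^+ l)).
  rewrite -lhs; apply: ler_pM.
  - by rewrite mulr_ge0// mulr_ge0 ?sqr_ge0 ?expR_ge0.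
  - by rewrite mulr_ge0// ?exprn_ge0// exprn_ge0.
  - by rewrite ler_wpM2l// ler_wpM2l// sqr_ge0.
  - by rewrite ler_wpM2l// exprn_ge0// exprn_ge0.
rewrite ler_wpM2l ?mulr_ge0 ?exprn_ge0//.
by rewrite lerXn2r ?nnegrE ?invr_ge0 ?(ltW q0)// /q; lra.
Qed.

End geometric_bounds.

(** * Almost sure bounds along powers of two *)

Section shortest_distance.
Context (R : realType) (N : nat) (Omega : topologicalType) (w0 : Omega).
Context (X : set 'rV[R]_N) (x0 : X) (P : probability (borel w0) R).
Context (theta : Omega -> Omega) (T : Omega -> X -> X).
Context (mu : probability (borel w0 * borel x0)%type R).
Hypothesis inv : rds_invariant P theta T mu.
Local Notation Y := (borel x0).
Local Notation Z := (borel w0 * borel x0)%type.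
Local Notation nu := (marginal mu).

(** [m_n] along the pair of orbits started at [z]. *)
Let sd (z : Z * Z) (n : nat) : \bar R :=
  shortest_dist theta T n z.1.1 z.2.1 z.1.2 z.2.2.

Lemma corr_integral_le_powR c : (c%:E < lower_corr_dim nu)%E ->
  exists2 d, 0 < d & forall r, 0 < r < d -> corr_integral nu r <= r `^ c.
Proof.
move=> /limf_einf_gt[e /= e0 He]; exists (Num.min 1 e); first by rewrite lt_min ltr01.
move=> r /andP[r0]; rewrite lt_min => /andP[r1 re].
apply: powR_le_of_slope_gt; rewrite ?corr_integral_ge0 ?r0//.
have := He r; rewrite /= sub0r normrN gtr0_norm// => /(_ re r0).
by rewrite /corr_rate corr_integralE.
Qed.

Lemma powR_le_corr_integral c : (upper_corr_dim nu < c%:E)%E ->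
  exists2 d, 0 < d & forall r, 0 < r < d -> r `^ c <= corr_integral nu r.
Proof.
move=> /limf_esup_lt[e /= e0 He]; exists (Num.min 1 e); first by rewrite lt_min ltr01.
move=> r /andP[r0]; rewrite lt_min => /andP[r1 re].
apply: powR_ge_of_slope_lt; rewrite ?corr_integral_ge0 ?r0//.
have := He r; rewrite /= sub0r normrN gtr0_norm// => /(_ re r0).
by rewrite /corr_rate corr_integralE.
Qed.

Let pow_base (k : R) : 0 < k -> 0 < 2 `^ (- k) < 1.
Proof. by move=> k0; rewrite powR_gt0//= powR2_lt1// oppr_lt0. Qed.

Lemma ae_shortest_dist_ge k c : 0 < k -> (c%:E < lower_corr_dim nu)%E ->
  2 < k * c ->
  {ae (mu \x mu)%E, forall z, exists L, forall l, (L <= l)%N ->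
    (((2 `^ (- k)) ^+ l)%:E <= sd z (2 ^ l)%N)%E}.
Proof.
move=> k0 /corr_integral_le_powR[d d0 Hd] kc.
set b := 2 `^ (- k); have /andP[b0 b1] := pow_base k0.
have [l0 Hl0] : exists l0, forall l, (l0 <= l)%N -> b ^+ l < d.
  by apply: exprn_lt_eventually => //; rewrite b1 ltW.
(* The ratio of [n ^ 2 * r ^ c] along [n = 2 ^ l] and [r = b ^ l]. *)
pose q := 2 `^ (2 - k * c).
have qE : q = 2 ^+ 2 * b `^ c.
  rewrite /q /b -powRrM mulNr powRD; last by rewrite pnatr_eq0 implybT.
  by rewrite powR_mulrn.
have hit_small l : (l0 <= l)%N ->
    ((mu \x mu)%E (hit_set theta T (2 ^ l) (b ^+ l)) <= (1 * q ^+ l)%:E)%E.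
  move=> ll; apply: le_trans (hit_prob_le inv _ _) _.
  rewrite lee_fin mul1r qE exprMn -exprM mulnC exprM natrX ler_wpM2l ?exprn_ge0//.
  by rewrite -(powR_exprn c l (ltW b0)) Hd// exprn_gt0//= Hl0.
have q01 : 0 < q < 1 by rewrite powR_gt0//= powR2_lt1// subr_lt0.
have := ae_eventually_notin (fun l => measurable_hit_set inv (2 ^ l) (b ^+ l))
  ler01 q01 hit_small.
apply: filterS => z [L HL]; exists L => l /HL nhit.
rewrite leNgt; apply: contra_notN nhit => /shortest_dist_ltP[i [j ij]].
rewrite /hit_set/= /hit_count (bigD1 (i, j))//= indicE mem_set//= lerDl.
by apply: sumr_ge0 => p _; rewrite indicE.
Qed.

Section hitting.
Context (alpha : R).
Hypothesis alpha01 : 0 < alpha <= 1.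
Hypothesis dec : annealed_decay alpha theta T mu.

Let x := @orbit_pt R N Omega w0 X x0 theta T.

(** No pair of orbit points before time [n] contributes to the smoothed count
   of close pairs. *)
Definition smooth_miss_set n r : set (Z * Z) :=
  [set z | \sum_(p : 'I_n * 'I_n)
    smooth_ball r (orbit_pt theta T p.1 z.1, orbit_pt theta T p.2 z.2) = 0].

Lemma measurable_smooth_miss_set n r : measurable (smooth_miss_set n r).
Proof.
pose s (z : Z * Z) := \sum_(p : 'I_n * 'I_n)
  smooth_ball r (orbit_pt theta T p.1 z.1, orbit_pt theta T p.2 z.2).
have ms : measurable_fun setT s.
  apply: measurable_sum => p.
  apply: (measurableT_comp (f := smooth_ball r)) => //.
    exact: (bnd_meas_smooth_ball x0 r).1.
  apply: measurable_fun_pair.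
    exact: (measurableT_comp (measurable_orbit_pt inv _) measurable_fst).
  exact: (measurableT_comp (measurable_orbit_pt inv _) measurable_snd).
rewrite (_ : smooth_miss_set n r = setT `&` s @^-1` [set 0]); first exact: ms.
by rewrite setTI.
Qed.

Lemma smooth_miss_prob_le n r g u : (0 < n)%N -> (0 < g)%N -> 0 < r <= 1 ->
  0 < smooth_corr nu r -> u = (n%:R * Num.sqrt (smooth_corr nu r))^-1 ->
  ((mu \x mu)%E (smooth_miss_set n r) <=
    (2 * ((4 / r) ^+ 2 * expR (- g%:R)) * (n%:R ^+ 4 * u ^+ 4) +
     4 * g%:R * (cell_count N)%:R * u + 4 * (g%:R * u) ^+ 2)%:E)%E.
Proof.
move=> n0 g0 /andP[r0 r1]; set H := smooth_corr nu r => H0 uE.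
have L1 : 1 <= 2 / r by rewrite ler_pdivlMr// mul1r (le_trans r1)// ler1n.
have sb01 (f : Y -> R) : (forall y, 0 <= f y) -> (forall y, f y <= 1) ->
  forall y, 0 <= f y <= 1 by move=> h1 h2 y; rewrite h1 h2.
pose e0 := (1 + 2 / r) ^+ 2 * expR (- g%:R).
have e00 : 0 <= e0 by rewrite mulr_ge0 ?sqr_ge0 ?expR_ge0.
have bs y : bnd_meas (fun a : Y => smooth_ball r (a, y)).
  exact: (bnd_meas_ysection (bnd_meas_smooth_ball x0 r)).
have decay (f f' : Y -> R) i i' : bnd_meas f -> bnd_meas f' ->
    (forall y, 0 <= f y <= 1) -> (forall y, 0 <= f' y <= 1) ->
    (forall a b : Y, `|f a - f b| <= 2 / r * eucl_dist a b) ->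
    (forall a b : Y, `|f' a - f' b| <= 2 / r * eucl_dist a b) ->
    ~~ close_times g i i' ->
    \int[mu]_z (f (x i z) * f' (x i' z)) <=
    (\int[nu]_y f y) * (\int[nu]_y f' y) + e0.
  move=> bf bf' f01 f01' fL fL'; rewrite /close_times negb_and -!leqNgt => /orP[ig|gi].
    exact: (decay_orbit_pt inv alpha01 L1 dec bf bf' f01 f01' fL fL' g0 ig).
  rewrite [X in X + _]mulrC; under eq_Rintegral do rewrite mulrC.
  exact: (decay_orbit_pt inv alpha01 L1 dec bf' bf f01' f01 fL' fL g0 gi).
have sm01 y : 0 <= smooth_measure nu r y <= 1.
  by rewrite smooth_measure_ge0 smooth_measure_le1.
have := @second_moment_hitting _ _ Z Y R mu nu x (smooth_ball r) g e0
  ((cell_count N)%:R * Num.sqrt H) (measurable_orbit_pt inv)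
  (bnd_meas_smooth_ball x0 r) (smooth_ball_le1 r) (smooth_ballC r)
  (integral_orbit_pt inv) e00.
move=> /(_ _ _ _ n n0 H0)/le_trans; apply.
- move=> i i' y y' far.
  apply: decay => // a; rewrite ?smooth_ball_ge0 ?smooth_ball_le1// => b.
    exact: smooth_ball_lip.
  exact: smooth_ball_lip.
- move=> i i' far; rewrite expr2; apply: decay => //.
  - exact: bnd_meas_smooth_measure.
  - exact: bnd_meas_smooth_measure.
  - by move=> a b; exact: smooth_measure_lip.
  - by move=> a b; exact: smooth_measure_lip.
- by move=> y; exact: smooth_measure_le_sqrt.
rewrite lee_fin -/H.
have sH : 0 < Num.sqrt H by rewrite sqrtr_gt0.
have HE : H = Num.sqrt H ^+ 2 by rewrite sqr_sqrtr// ltW.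
have nR : n%:R != 0 :> R by rewrite pnatr_eq0 -lt0n.
have -> : 2 * e0 / H ^+ 2 = 2 * e0 * (n%:R ^+ 4 * u ^+ 4).
  by rewrite uE [in LHS]HE; field; rewrite nR gt_eqF.
have -> : 4 * g%:R * ((cell_count N)%:R * Num.sqrt H) / (n%:R * H) =
    4 * g%:R * (cell_count N)%:R * u.
  rewrite uE; move: (Num.sqrt H) sH HE => v v0 ->.
  by field; rewrite nR gt_eqF.
have -> : 4 * g%:R ^+ 2 / (n%:R ^+ 2 * H) = 4 * (g%:R * u) ^+ 2.
  by rewrite uE [in LHS]HE; field; rewrite nR gt_eqF.
rewrite !lerD2r ler_wpM2r//.
  by rewrite mulr_ge0// exprn_ge0// uE invr_ge0 mulr_ge0// ltW.
have h1 : 0 <= 1 + 2 / r by rewrite addr_ge0// (le_trans _ L1).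
have h2 : 1 + 2 / r <= 4 / r.
  by rewrite (_ : 4 / r = 2 / r + 2 / r) ?lerD2r//; field; rewrite gt_eqF.
rewrite ler_wpM2l// ler_wpM2r ?expR_ge0// ler_pXn2r ?nnegrE//.
exact: le_trans h2.
Qed.

Lemma ae_shortest_dist_le k c : 0 < k -> 0 < c -> (upper_corr_dim nu < c%:E)%E ->
  k * c < 2 ->
  {ae (mu \x mu)%E, forall z, exists L, forall l, (L <= l)%N ->
    (sd z (2 ^ l)%N <= ((2 `^ (- k)) ^+ l)%:E)%E}.
Proof.
move=> k0 c0 /powR_le_corr_integral[d d0 Hd] kc.
set b := 2 `^ (- k); have /andP[b0 b1] := pow_base k0.
have b01 : 0 <= b < 1 by rewrite b1 ltW.
have [l0 Hl0] := exprn_lt_eventually b01 d0.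
(* [1 / (n * sqrt H) <= a * s ^ l] for the smoothed correlation integral [H]. *)
pose s := 2 `^ ((k * c - 2) / 2) : R.
pose a := 2 `^ (c / 2) : R.
have s01 : 0 < s < 1 by rewrite powR_gt0//= powR2_lt1//; lra.
have a0 : 0 < a by rewrite powR_gt0.
have [A [D [q [D0 q01 Hq]]]] :=
  second_moment_geometric (ltW a0) (ler0n R (cell_count N)) s01 b0.
have miss_small l : (l0 <= l)%N ->
    ((mu \x mu)%E (smooth_miss_set (2 ^ l) (b ^+ l)) <= (D * q ^+ l)%:E)%E.
  move=> ll; set r := b ^+ l.
  have r0 : 0 < r by rewrite exprn_gt0.
  have r1 : r <= 1 by rewrite exprn_ile1// ltW.
  have rd : 0 < r / 2 < d.
    by rewrite divr_gt0//= (le_lt_trans _ (Hl0 _ ll))// -/r; lra.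
  have Hr : (r / 2) `^ c <= smooth_corr nu r.
    exact: le_trans (Hd _ rd) (corr_integral_le_smooth nu r0).
  have H0 : 0 < smooth_corr nu r by rewrite (lt_le_trans _ Hr)// powR_gt0// divr_gt0.
  apply: le_trans (smooth_miss_prob_le _ (_ : 0 < A * l + 1)%N _ H0 erefl) _.
  - by rewrite expn_gt0.
  - by rewrite addn1.
  - by rewrite r0.
  rewrite lee_fin natrX; apply: Hq.
    by rewrite invr_ge0 mulr_ge0// exprn_ge0.
  have sl0 : 0 < s ^+ l by rewrite exprn_gt0//; case/andP: s01.
  have n0 : 0 < 2 ^+ l :> R by rewrite exprn_gt0.
  have sH0 : 0 < Num.sqrt (smooth_corr nu r) by rewrite sqrtr_gt0.
  have asn0 : 0 < a * s ^+ l * (2 ^+ l * Num.sqrt (smooth_corr nu r)).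
    by rewrite mulr_gt0// mulr_gt0.
  rewrite -[leLHS]div1r ler_pdivrMr ?mulr_gt0//.
  rewrite -(ler_pXn2r (ltn0Sn 1)) ?nnegrE ?ler01// ?(ltW asn0)// expr1n.
  rewrite !exprMn sqr_sqrtr ?(ltW H0)// mulrA.
  apply: le_trans (ler_wpM2l _ Hr); last first.
    by rewrite mulr_ge0 ?sqr_ge0// mulr_ge0 ?sqr_ge0.
  rewrite le_eqVlt; apply/orP; left; apply/eqP.
  have aa : a ^+ 2 = 2 `^ c.
    by rewrite -powR_mulrn ?powR_ge0// -powRrM; congr (_ `^ _); field.
  have bc : b `^ c = (2 `^ (k * c))^-1 by rewrite /b -powRrM mulNr powRN.
  have ss : s ^+ 2 = 2 `^ (k * c) / 2 ^+ 2.
    rewrite -powR_mulrn ?powR_ge0// -powRrM -powR_mulrn//.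
    rewrite -powRB; last by rewrite pnatr_eq0 implybT.
    by congr (_ `^ _); field.
  have -> : (r / 2) `^ c = (2 `^ (k * c)) ^- l / 2 `^ c.
    rewrite powRM ?invr_ge0// ?(ltW r0)// powR_exprn ?(ltW b0)// bc exprVn.
    by congr (_ * _); rewrite -[2^-1]powR_inv1// -powRrM mulN1r powRN.
  rewrite aa -[(s ^+ l) ^+ 2]exprM mulnC exprM ss expr_div_n.
  have p1 : 2 `^ (k * c) ^+ l != 0 by rewrite expf_neq0// gt_eqF// powR_gt0.
  have p2 : 2 `^ c != 0 by rewrite gt_eqF// powR_gt0.
  have p3 : 2 ^+ l != 0 :> R by rewrite expf_neq0.
  have p4 : (2 ^+ 2) ^+ l = (2 ^+ l) ^+ 2 :> R by rewrite -!exprM mulnC.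
  by rewrite p4; field; rewrite p1 p2 p3.
have := ae_eventually_notin
  (fun l => measurable_smooth_miss_set (2 ^ l) (b ^+ l)) D0 q01 miss_small.
apply: filterS => z [L HL]; exists L => l /HL nmiss.
rewrite leNgt; apply/negP => far; apply: nmiss.
rewrite /smooth_miss_set/= big1// => -[i j] _ /=.
apply: smooth_ball_eq0; first by rewrite exprn_gt0.
rewrite leNgt; apply/negP => ij.
have : (sd z (2 ^ l)%N < (b ^+ l)%:E)%E by apply/shortest_dist_ltP; exists i, j.
by rewrite ltNge (ltW far).
Qed.

End hitting.
End shortest_distance.

(** * Rates of the shortest distance *)

(** The bound [2 / D] is a real number, equal to 0 when [D] is infinite. *)
Lemma ediv2_gt0 (R : realType) (D : \bar R) : (0 < D)%E ->
  exists2 t : R, 0 <= t & (2%:E / D)%E = t%:E.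
Proof.
case: D => [D||//]; last by exists 0 => //; rewrite mule0.
rewrite lte_fin => D0; exists (2 / D); first by rewrite divr_ge0// ltW.
by rewrite ediv_EFinE ?gt_eqF.
Qed.

Section rates.
Context (R : realType) (N : nat) (Omega : topologicalType) (w0 : Omega).
Context (X : set 'rV[R]_N) (x0 : X) (P : probability (borel w0) R).
Context (theta : Omega -> Omega) (T : Omega -> X -> X).
Context (mu : probability (borel w0 * borel x0)%type R).
Hypothesis inv : rds_invariant P theta T mu.
Local Notation nu := (marginal mu).
Hypothesis lower_gt0 : (0 < lower_corr_dim nu)%E.

Lemma upper_corr_dim_gt0 : (0 < upper_corr_dim nu)%E.
Proof. by apply: lt_le_trans lower_gt0 _; exact: limf_einf_le_esup. Qed.

Lemma ae_limn_esup_shortest_rate :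
  {ae (mu \x mu)%E, forall z,
    (limn_esup (shortest_rate theta T z) <= 2%:E / lower_corr_dim nu)%E}.
Proof.
have [t t0 tE] := ediv2_gt0 lower_gt0; rewrite tE.
apply: ae_limn_esup_le => k tk.
pose k1 := (t + k) / 2.
have k10 : 0 < k1 by rewrite /k1; lra.
have tk1 : t < k1 by rewrite /k1; lra.
have k1k : k1 < k by rewrite /k1; lra.
(* [2 / k1 < c < lower_corr_dim nu] *)
have [c cl kc] : exists2 c, (c%:E < lower_corr_dim nu)%E & 2 < k1 * c.
  have : ((2 / k1)%:E < lower_corr_dim nu)%E.
    case: (lower_corr_dim nu) lower_gt0 tE => [D||//]; last by move=> _ _; exact: ltry.
    rewrite lte_fin => D0; rewrite ediv_EFinE ?gt_eqF// => -[tD].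
    by rewrite lte_fin ltr_pdivrMr// mulrC -ltr_pdivrMr// tD.
  move=> /ereal_dense[c /andP[h1 h2]]; exists c => //.
  by rewrite mulrC -ltr_pdivrMr// -lte_fin.
apply: filterS (ae_shortest_dist_ge inv k10 cl kc) => z Hz.
apply: (slope_le_of_pow2 _ k10 k1k Hz) => m n mn; exact: shortest_dist_dec.
Qed.

Lemma ae_limn_einf_shortest_rate (alpha : R) : 0 < alpha <= 1 ->
  annealed_decay alpha theta T mu ->
  {ae (mu \x mu)%E, forall z,
    (2%:E / upper_corr_dim nu <= limn_einf (shortest_rate theta T z))%E}.
Proof.
move=> alpha01 dec.
have [t t0 tE] := ediv2_gt0 upper_corr_dim_gt0; rewrite tE.
apply: ae_limn_einf_ge => k kt.
have [k0|k0] := ltP k 0.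
  apply: aeW => z.
  apply: (@slope_ge_of_fin _ (fun n => shortest_dist theta T n z.1.1 z.2.1 z.1.2 z.2.2))
    => //.
  - by move=> n; exact: shortest_dist_ge0.
  - by move=> m n mn; exact: shortest_dist_dec.
  - by rewrite /shortest_dist !big_ord1 ltry.
pose k1 := (k + t) / 2.
have k10 : 0 < k1 by rewrite /k1; lra.
have k1t : k1 < t by rewrite /k1; lra.
have kk1 : k < k1 by rewrite /k1; lra.
(* [upper_corr_dim nu < c < 2 / k1] *)
have [c cu [c0 kc]] : exists2 c, (upper_corr_dim nu < c%:E)%E & 0 < c /\ k1 * c < 2.
  have : (upper_corr_dim nu < (2 / k1)%:E)%E.
    case: (upper_corr_dim nu) upper_corr_dim_gt0 tE => [D||//]; last first.
      by move=> _; rewrite mule0 => -[tD]; move: kt; rewrite -tD ltNge k0.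
    rewrite lte_fin => D0; rewrite ediv_EFinE ?gt_eqF// => -[tD].
    by rewrite lte_fin ltr_pdivlMr// mulrC -ltr_pdivlMr// tD.
  move=> /ereal_dense[c /andP[h1 h2]]; exists c => //; split.
    by rewrite -lte_fin (lt_trans upper_corr_dim_gt0).
  by rewrite mulrC -ltr_pdivlMr// -lte_fin.
apply: filterS (ae_shortest_dist_le inv alpha01 dec k10 c0 cu kc) => z Hz.
apply: (slope_ge_of_pow2 _ _ k0 kk1 Hz).
  by move=> n; exact: shortest_dist_ge0.
by move=> m n mn; exact: shortest_dist_dec.
Qed.

Lemma ae_cvg_shortest_rate (alpha : R) (C : \bar R) : 0 < alpha <= 1 ->
  annealed_decay alpha theta T mu ->
  corr_rate nu r @[r --> 0^'+] --> C ->
  {ae (mu \x mu)%E, forall z,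
    shortest_rate theta T z n @[n --> \oo] --> (2%:E / C)%E}.
Proof.
move=> alpha01 dec /cvg_limf_einf_esup[lowerE upperE].
have := ae_limn_esup_shortest_rate; have := ae_limn_einf_shortest_rate alpha01 dec.
rewrite /lower_corr_dim lowerE /upper_corr_dim upperE.
apply: (@filterS2 _ _ (ae_filter_ringOfSetsType (mu \x mu)%E)) => z.
exact: cvg_of_limn_einf_esup.
Qed.

End rates.

Theorem theorem4p4 (R : realType) (N : nat)
    (Omega : metricType R) (w0 : Omega)
    (X : set 'rV[R]_N) (x0 : X)
    (P : probability (borel w0) R)
    (theta : Omega -> Omega) (T : Omega -> X -> X)
    (mu : probability (borel w0 * borel x0)%type R)
    (alpha : R) :
  0 < alpha -> alpha <= 1 ->
  is_rds x0 P theta T ->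
  rds_invariant P theta T mu ->
  (0 < lower_corr_dim (marginal mu))%E ->
  {ae (mu \x mu)%E, forall z,
     (limn_esup (shortest_rate theta T z)
        <= 2%:E / lower_corr_dim (marginal mu))%E} /\
  (annulus_regular (marginal mu) -> annealed_decay alpha theta T mu ->
   {ae (mu \x mu)%E, forall z,
      (2%:E / upper_corr_dim (marginal mu)
         <= limn_einf (shortest_rate theta T z))%E} /\
   (forall C : \bar R,
      corr_rate (marginal mu) r @[r --> 0^'+] --> C ->
      {ae (mu \x mu)%E, forall z,
         shortest_rate theta T z n @[n --> \oo] --> (2%:E / C)%E})).
Proof.
move=> a0 a1 _ inv lower0.
have alpha01 : 0 < alpha <= 1 by rewrite a0.
split; first exact: (ae_limn_esup_shortest_rate inv lower0).
move=> _ dec; split; first exact: (ae_limn_einf_shortest_rate inv lower0 alpha01 dec).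
by move=> C; exact: (ae_cvg_shortest_rate inv lower0 alpha01 dec).
Qed.
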